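(* Let $\Omega\subset\mathbb{C}^n$ be a domain with a $C^2$ defining function $r$ for which there is a constant $C>0$ such that for every $p\in\partial\Omega$ and every $t\in\mathbb{C}^n$ with $\sum_{j=1}^n\frac{\partial r}{\partial z_j}(p)t_j=0$, \[ \sum_{j,k=1}^n\frac{\partial^2 r}{\partial z_j\partial\bar z_k}(p)\,t_j\bar t_k\ \geq\ C\,|\nabla r(p)|\sum_{j=1}^n|t_j|^2 . \] (1) If $\Omega$ admits a uniformly $C^2$ defining function, then there exists a $C^2$ defining function for $\Omega$ which is strictly plurisubharmonic at every point of $\partial\Omega$. (2) If $\Omega$ admits a uniformly $C^3$ defining function, then there exist $\varepsilon>0$ and a $C^2$ function $\rho$ defined on an open set containing $\overline\Omega$ such that $\rho$ is a defining function for $\Omega$ near $\partial\Omega$, $\rho<0$ on $\Omega$, $\rho$ is plurisubharmonic on $\Omega$, and $\rho$ is strictly plurisubharmonic on $\{z\in\Omega:\operatorname{dist}(z,\partial\Omega)<\varepsilon\}$.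
   Context: Identify $\mathbb{C}^n$ with $\mathbb{R}^{2n}$; $\nabla r$ is the real gradient. A $C^m$ defining function for an open set $\Omega$ is a real-valued $C^m$ function $\rho$ on an open neighborhood $U$ of $\partial\Omega$ with $\{x\in U:\rho<0\}=\Omega\cap U$ and $\nabla\rho\neq0$ on $\partial\Omega$. It is uniformly $C^m$ if $\operatorname{dist}(\partial\Omega,\partial U)>0$, $\sup_{U}\sum_{|\alpha|\le m}|\partial^\alpha\rho|<\infty$ (real derivatives), and $\inf_U|\nabla\rho|>0$. A real $C^2$ function is (strictly) plurisubharmonic at a point if its complex Hessian $\big(\frac{\partial^2\rho}{\partial z_j\partial\bar z_k}\big)$ is positive semidefinite (positive definite) there. *)

(* Defs.v *)
From Stdlib Require Import Reals Lra List ClassicalEpsilon.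
Open Scope R_scope.

(* Points of R^d are represented as functions nat -> R whose coordinates
   of index >= d vanish.  C^n is identified with R^(2n) via
   z_j = x_j + i x_(n+j), j = 0..n-1. *)
Definition Pt := nat -> R.

Fixpoint rsum (k : nat) (f : nat -> R) : R :=
  match k with O => 0 | S k' => rsum k' f + f k' end.

Definition inRd (d : nat) (x : Pt) : Prop := forall i, (d <= i)%nat -> x i = 0.

Definition distRd (d : nat) (x y : Pt) : R := sqrt (rsum d (fun i => (x i - y i) ^ 2)).

Definition openRd (d : nat) (U : Pt -> Prop) : Prop :=
  (forall x, U x -> inRd d x) /\
  forall x, U x -> exists eps, 0 < eps /\
    forall y, inRd d y -> distRd d x y < eps -> U y.

Definition boundary (d : nat) (S : Pt -> Prop) (x : Pt) : Prop :=
  inRd d x /\ forall eps, 0 < eps ->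
    (exists y, S y /\ inRd d y /\ distRd d x y < eps) /\
    (exists y, ~ S y /\ inRd d y /\ distRd d x y < eps).

Definition closure (d : nat) (S : Pt -> Prop) (x : Pt) : Prop :=
  inRd d x /\ forall eps, 0 < eps -> exists y, S y /\ inRd d y /\ distRd d x y < eps.

Definition domain (d : nat) (D : Pt -> Prop) : Prop :=
  openRd d D /\ (exists x, D x) /\
  forall A B : Pt -> Prop, openRd d A -> openRd d B ->
    (forall x, D x <-> A x \/ B x) -> (forall x, ~ (A x /\ B x)) ->
    (exists x, A x) -> (exists x, B x) -> False.

Definition upd (x : Pt) (i : nat) (h : R) : Pt :=
  fun k => if Nat.eqb k i then x k + h else x k.

Definition has_partial (i : nat) (f : Pt -> R) (x : Pt) (l : R) : Prop :=
  forall eps, 0 < eps -> exists delta, 0 < delta /\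
    forall h, h <> 0 -> Rabs h < delta ->
      Rabs ((f (upd x i h) - f x) / h - l) < eps.

Definition pd (i : nat) (f : Pt -> R) (x : Pt) : R :=
  epsilon (inhabits 0) (has_partial i f x).

Definition continuous_on (d : nat) (U : Pt -> Prop) (f : Pt -> R) : Prop :=
  forall x, U x -> forall eps, 0 < eps -> exists delta, 0 < delta /\
    forall y, inRd d y -> U y -> distRd d x y < delta -> Rabs (f y - f x) < eps.

Fixpoint Cm (d m : nat) (U : Pt -> Prop) (f : Pt -> R) : Prop :=
  match m with
  | O => continuous_on d U f
  | S m' => continuous_on d U f /\
      forall i, (i < d)%nat ->
        (forall x, U x -> exists l, has_partial i f x l) /\ Cm d m' U (pd i f)
  end.

Definition pdl (l : list nat) (f : Pt -> R) : Pt -> R :=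
  fold_right (fun i g => pd i g) f l.

Definition grad_norm (d : nat) (f : Pt -> R) (x : Pt) : R :=
  sqrt (rsum d (fun i => (pd i f x) ^ 2)).

Definition is_defining (d m : nat) (Om U : Pt -> Prop) (rho : Pt -> R) : Prop :=
  openRd d U /\
  (forall p, boundary d Om p -> U p) /\
  Cm d m U rho /\
  (forall x, U x -> (rho x < 0 <-> Om x)) /\
  (forall p, boundary d Om p -> grad_norm d rho p <> 0).

Definition unif_defining (d m : nat) (Om U : Pt -> Prop) (rho : Pt -> R) : Prop :=
  is_defining d m Om U rho /\
  (exists delta, 0 < delta /\
     forall p q, boundary d Om p -> boundary d U q -> delta <= distRd d p q) /\
  (exists M, forall l : list nat, (length l <= m)%nat -> Forall (fun i => (i < d)%nat) l ->
     forall x, U x -> Rabs (pdl l rho x) <= M) /\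
  (exists c, 0 < c /\ forall x, U x -> c <= grad_norm d rho x).

Record Cx := mkCx { cre : R; cim : R }.
Definition C0 : Cx := mkCx 0 0.
Definition Cadd (a b : Cx) : Cx := mkCx (cre a + cre b) (cim a + cim b).
Definition Cmul (a b : Cx) : Cx :=
  mkCx (cre a * cre b - cim a * cim b) (cre a * cim b + cim a * cre b).
Definition Cconj (a : Cx) : Cx := mkCx (cre a) (- cim a).
Fixpoint Csum (k : nat) (f : nat -> Cx) : Cx :=
  match k with O => C0 | S k' => Cadd (Csum k' f) (f k') end.
Definition Cabs2 (a : Cx) : R := cre a ^ 2 + cim a ^ 2.

Definition cnorm2 (n : nat) (t : nat -> Cx) : R := rsum n (fun j => Cabs2 (t j)).

(* d f / d z_j = 1/2 (d/dx_j - i d/dy_j) f, with y_j = x_(n+j) *)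
Definition dz (n : nat) (f : Pt -> R) (x : Pt) (j : nat) : Cx :=
  mkCx (pd j f x / 2) (- pd (n + j) f x / 2).

(* d^2 f / dz_j d zbar_k = 1/4 [(f_{x_j x_k} + f_{y_j y_k}) + i (f_{x_j y_k} - f_{y_j x_k})] *)
Definition ddbar (n : nat) (f : Pt -> R) (x : Pt) (j k : nat) : Cx :=
  mkCx ((pd j (pd k f) x + pd (n + j) (pd (n + k) f) x) / 4)
       ((pd j (pd (n + k) f) x - pd (n + j) (pd k f) x) / 4).

Definition levi (n : nat) (f : Pt -> R) (x : Pt) (t : nat -> Cx) : Cx :=
  Csum n (fun j => Csum n (fun k =>
    Cmul (Cmul (ddbar n f x j k) (t j)) (Cconj (t k)))).

Definition cx_tangent (n : nat) (f : Pt -> R) (p : Pt) (t : nat -> Cx) : Prop :=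
  Csum n (fun j => Cmul (dz n f p j) (t j)) = C0.

Definition psh_at (n : nat) (f : Pt -> R) (x : Pt) : Prop :=
  forall t : nat -> Cx, 0 <= cre (levi n f x t).

Definition spsh_at (n : nat) (f : Pt -> R) (x : Pt) : Prop :=
  forall t : nat -> Cx, (exists j, (j < n)%nat /\ t j <> C0) -> 0 < cre (levi n f x t).

(* Main.v *)
(** Let r be a uniformly C^2 defining function.  The new function is F(r), where
F(s) = max(0, s + eta)^3 - eta^3 is convex, nondecreasing, C^2 and constant for
s <= - eta.  Since F''/F' = 2 / (s + eta) >= 2 / eta for - eta < s <= 0, a small eta makes
the rank-one term F''(r) |<dr, t>|^2 dominate the directions transverse to the
boundary, while the Levi condition controls the complex tangential ones.

The Levi condition passes from the given defining function to r because the
normalized Hessian on tangent vectors depends only on Om: it tells which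
parabolas p + s v + s^2 w enter Om.

When r is uniformly C^3, its Hessian is Lipschitz, so the estimate persists on a
collar of the boundary of fixed width; the lower bound on |grad r| gives
r <= - eta at the inner edge of that collar, where F(r) is therefore glued to
the constant - eta^3. *)

From Stdlib Require Import Reals Lra Lia FunctionalExtensionality PropExtensionality.
From Stdlib Require Import Classical ClassicalEpsilon.
From Coquelicot Require Import Coquelicot.
Require Import Defs.
Open Scope R_scope.

(** The boundary may be unbounded, so compactness cannot supply common constants. The Levi
    inequality is given for one defining function and the derivative bounds for another, yet both
    are needed for the same function. Once the inequality is transferred, the bounds on [hess r] and
    on the gradient yield a single pair [k], [L] for which the Levi form plus [L] times the rank-one
    term is coercive at every boundary point.

    The transfer does not write one defining function as a multiple of the other: for C^2 functions
    the quotient is in general only C^1, so the product rule for second derivatives breaks down.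
    Testing parabolas uses only second-order Taylor expansions at the boundary point.

    F''/F' grows as s decreases to -eta, so the one condition [eta * L <= 2] serves the whole range
    -eta < s <= 0. In part (2) all widths are fixed in the order [a], [s], [eta], [eps], each
    depending on the previous ones and on the uniform bounds. *)

(** * Finite real sums *)

Lemma rsum_ext (k : nat) (f g : nat -> R) :
  (forall i, (i < k)%nat -> f i = g i) -> rsum k f = rsum k g.
Proof.
  induction k as [|k IH]; intros H; simpl; [reflexivity|].
  rewrite IH, H; auto.
Qed.

Lemma rsum_plus (k : nat) (f g : nat -> R) :
  rsum k (fun i => f i + g i) = rsum k f + rsum k g.
Proof. induction k as [|k IH]; simpl; [|rewrite IH]; ring. Qed.

Lemma rsum_scal (k : nat) (a : R) (f : nat -> R) :
  rsum k (fun i => a * f i) = a * rsum k f.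
Proof. induction k as [|k IH]; simpl; [|rewrite IH]; ring. Qed.

Lemma rsum_minus (k : nat) (f g : nat -> R) :
  rsum k (fun i => f i - g i) = rsum k f - rsum k g.
Proof. induction k as [|k IH]; simpl; [|rewrite IH]; ring. Qed.

Lemma rsum_le (k : nat) (f g : nat -> R) :
  (forall i, (i < k)%nat -> f i <= g i) -> rsum k f <= rsum k g.
Proof.
  induction k as [|k IH]; intros H; simpl; [lra|].
  apply Rplus_le_compat; auto.
Qed.

Lemma rsum_const (k : nat) (a : R) : rsum k (fun _ => a) = INR k * a.
Proof. induction k as [|k IH]; [simpl; ring|]. rewrite S_INR; simpl; rewrite IH; ring. Qed.

Lemma rsum_nonneg (k : nat) (f : nat -> R) :
  (forall i, (i < k)%nat -> 0 <= f i) -> 0 <= rsum k f.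
Proof.
  intros H. replace 0 with (rsum k (fun _ => 0)); [now apply rsum_le|].
  rewrite rsum_const; ring.
Qed.

Lemma rsum_Rabs (k : nat) (f : nat -> R) :
  Rabs (rsum k f) <= rsum k (fun i => Rabs (f i)).
Proof.
  induction k as [|k IH]; simpl; [rewrite Rabs_R0; lra|].
  eapply Rle_trans; [apply Rabs_triang|]. lra.
Qed.

Lemma rsum_term_le (k j : nat) (f : nat -> R) :
  (forall i, (i < k)%nat -> 0 <= f i) -> (j < k)%nat -> f j <= rsum k f.
Proof.
  induction k as [|k IH]; intros H Hj; [lia|]; simpl.
  destruct (Nat.eq_dec j k) as [->|Hne].
  - assert (0 <= rsum k f) by (apply rsum_nonneg; auto). lra.
  - assert (f j <= rsum k f) by (apply IH; auto; lia).
    assert (0 <= f k) by auto. lra.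
Qed.

Lemma rsum_swap (k l : nat) (f : nat -> nat -> R) :
  rsum k (fun i => rsum l (fun j => f i j)) = rsum l (fun j => rsum k (fun i => f i j)).
Proof.
  induction k as [|k IH]; simpl.
  - rewrite rsum_const; ring.
  - rewrite IH, rsum_plus; reflexivity.
Qed.

Lemma rsum_add (k l : nat) (f : nat -> R) :
  rsum (k + l) f = rsum k f + rsum l (fun i => f (k + i)%nat).
Proof.
  induction l as [|l IH]; simpl.
  - rewrite Nat.add_0_r; ring.
  - rewrite Nat.add_succ_r; simpl. rewrite IH; ring.
Qed.

(** * Inner product and norm on R^d *)

Definition dot (d : nat) (u v : Pt) : R := rsum d (fun i => u i * v i).
Definition nrm (d : nat) (u : Pt) : R := sqrt (dot d u u).
Definition psub (x y : Pt) : Pt := fun i => x i - y i.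
(** A single combinator for sums, differences and, with [b = 0] and a dummy [v], scalar multiples,
    so that bilinearity needs only one rewriting rule per argument. *)
Definition lin (a : R) (u : Pt) (b : R) (v : Pt) : Pt := fun i => a * u i + b * v i.

Lemma dot_comm (d : nat) (u v : Pt) : dot d u v = dot d v u.
Proof. apply rsum_ext; intros; ring. Qed.

Lemma dot_lin_l (d : nat) (a b : R) (u v w : Pt) :
  dot d (lin a u b v) w = a * dot d u w + b * dot d v w.
Proof.
  unfold dot, lin. rewrite <- !rsum_scal, <- rsum_plus. apply rsum_ext; intros; ring.
Qed.

Lemma dot_lin_r (d : nat) (a b : R) (u v w : Pt) :
  dot d w (lin a u b v) = a * dot d w u + b * dot d w v.
Proof. rewrite dot_comm, dot_lin_l, (dot_comm d u), (dot_comm d v); ring. Qed.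

Lemma dot_self_nonneg (d : nat) (u : Pt) : 0 <= dot d u u.
Proof. apply rsum_nonneg; intros; nra. Qed.

Lemma nrm_nonneg (d : nat) (u : Pt) : 0 <= nrm d u.
Proof. apply sqrt_pos. Qed.

Lemma nrm_sqr (d : nat) (u : Pt) : nrm d u * nrm d u = dot d u u.
Proof. apply sqrt_sqrt, dot_self_nonneg. Qed.

Lemma dot_sqr_le (d : nat) (u v : Pt) :
  dot d u v * dot d u v <= dot d u u * dot d v v.
Proof.
  set (U := dot d u u); set (V := dot d v v); set (D := dot d u v).
  assert (E : forall a b, 0 <= a * a * U + 2 * a * b * D + b * b * V).
  { intros a b. pose proof (dot_self_nonneg d (lin a u b v)) as H.
    rewrite dot_lin_l, !dot_lin_r, (dot_comm d v u) in H. fold U V D in H. lra. }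
  assert (HU : 0 <= U) by apply dot_self_nonneg.
  assert (HV : 0 <= V) by apply dot_self_nonneg.
  (* The choice (V, -D) gives V (U V - D^2) >= 0, which settles V > 0. The pair (-D, U) settles V =
     0 < U, and (1, 1), (1, -1) force D = 0 when both U and V vanish. *)
  pose proof (E V (- D)) as E1. pose proof (E (- D) U) as E2.
  pose proof (E 1 1) as E3. pose proof (E 1 (-1)) as E4.
  destruct (Req_dec V 0) as [ZV|NV].
  - destruct (Req_dec U 0) as [ZU|NU]; [|nra].
    rewrite ZU, ZV in *. assert (D = 0) by lra. nra.
  - assert (0 <= V * (U * V - D * D)) by nra.
    assert (0 < V) by lra. nra.
Qed.

Lemma dot_le_nrm (d : nat) (u v : Pt) : Rabs (dot d u v) <= nrm d u * nrm d v.
Proof.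
  rewrite <- (Rabs_pos_eq (nrm d u * nrm d v))
    by (apply Rmult_le_pos; apply nrm_nonneg).
  apply Rsqr_le_abs_0. unfold Rsqr.
  replace (nrm d u * nrm d v * (nrm d u * nrm d v))
    with ((nrm d u * nrm d u) * (nrm d v * nrm d v)) by ring.
  rewrite !nrm_sqr. apply dot_sqr_le.
Qed.

Lemma le_of_sqr_le (a b : R) : 0 <= b -> a * a <= b * b -> a <= b.
Proof. intros; nra. Qed.

Lemma nrm_lin_le (d : nat) (a b : R) (u v : Pt) :
  nrm d (lin a u b v) <= Rabs a * nrm d u + Rabs b * nrm d v.
Proof.
  pose proof (nrm_nonneg d u) as Hu. pose proof (nrm_nonneg d v) as Hv.
  pose proof (Rabs_pos a) as Ha. pose proof (Rabs_pos b) as Hb.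
  apply le_of_sqr_le.
  - apply Rplus_le_le_0_compat; apply Rmult_le_pos; assumption.
  - rewrite nrm_sqr, dot_lin_l, !dot_lin_r, (dot_comm d v u), <- !nrm_sqr.
    assert (H : a * b * dot d u v <= Rabs a * Rabs b * (nrm d u * nrm d v)).
    { eapply Rle_trans; [apply Rle_abs|]. rewrite !Rabs_mult.
      apply Rmult_le_compat_l; [now apply Rmult_le_pos|apply dot_le_nrm]. }
    assert (Ea : a * a = Rabs a * Rabs a) by (rewrite <- Rabs_mult, Rabs_pos_eq; nra).
    assert (Eb : b * b = Rabs b * Rabs b) by (rewrite <- Rabs_mult, Rabs_pos_eq; nra).
    replace (a * (a * (nrm d u * nrm d u) + b * dot d u v) +
             b * (a * dot d u v + b * (nrm d v * nrm d v)))
      with ((a * a) * (nrm d u * nrm d u) + 2 * (a * b * dot d u v) + (b * b) * (nrm d v * nrm d v))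
      by ring.
    rewrite Ea, Eb. nra.
Qed.

Lemma coord_le_nrm (d k : nat) (u : Pt) : (k < d)%nat -> Rabs (u k) <= nrm d u.
Proof.
  intros Hk. apply le_of_sqr_le; [apply nrm_nonneg|].
  rewrite nrm_sqr, <- Rabs_mult, Rabs_pos_eq by nra.
  apply (rsum_term_le d k (fun i => u i * u i)); [intros; nra|assumption].
Qed.

Lemma nrm_le_coord (d : nat) (u v : Pt) :
  (forall i, (i < d)%nat -> Rabs (u i) <= Rabs (v i)) -> nrm d u <= nrm d v.
Proof.
  intros H. apply sqrt_le_1_alt, rsum_le. intros i Hi. specialize (H i Hi).
  apply Rsqr_le_abs_1. exact H.
Qed.

Lemma rsum_Rabs_le_nrm (d : nat) (u : Pt) :
  rsum d (fun i => Rabs (u i)) <= INR d * nrm d u.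
Proof. rewrite <- rsum_const. apply rsum_le. intros; now apply coord_le_nrm. Qed.

Lemma distRd_nrm (d : nat) (x y : Pt) : distRd d x y = nrm d (psub x y).
Proof. unfold distRd, nrm, dot, psub. f_equal. apply rsum_ext; intros; ring. Qed.

Lemma grad_norm_nrm (d : nat) (f : Pt -> R) (x : Pt) :
  grad_norm d f x = nrm d (fun i => pd i f x).
Proof. unfold grad_norm, nrm, dot. f_equal. apply rsum_ext; intros; ring. Qed.

Lemma nrm_ext (d : nat) (u v : Pt) :
  (forall i, (i < d)%nat -> u i = v i) -> nrm d u = nrm d v.
Proof. intros H. unfold nrm, dot. f_equal. apply rsum_ext. intros; rewrite H; auto. Qed.

Lemma nrm_scal (d : nat) (a : R) (u : Pt) : nrm d (fun i => a * u i) = Rabs a * nrm d u.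
Proof.
  unfold nrm, dot.
  rewrite (rsum_ext d _ (fun i => (a * a) * (u i * u i))) by (intros; ring).
  rewrite rsum_scal, sqrt_mult_alt by nra. now rewrite <- (sqrt_Rsqr_abs a).
Qed.

Lemma distRd_sym (d : nat) (x y : Pt) : distRd d x y = distRd d y x.
Proof. unfold distRd. f_equal. apply rsum_ext; intros; ring. Qed.

Lemma distRd_nonneg (d : nat) (x y : Pt) : 0 <= distRd d x y.
Proof. apply sqrt_pos. Qed.

Lemma distRd_refl (d : nat) (x : Pt) : distRd d x x = 0.
Proof.
  unfold distRd. rewrite (rsum_ext d _ (fun _ => 0)) by (intros; ring).
  rewrite rsum_const, Rmult_0_r. apply sqrt_0.
Qed.

Lemma distRd_triangle (d : nat) (x y z : Pt) : distRd d x z <= distRd d x y + distRd d y z.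
Proof.
  rewrite !distRd_nrm.
  replace (psub x z) with (lin 1 (psub x y) 1 (psub y z))
    by (apply functional_extensionality; intro; unfold lin, psub; ring).
  eapply Rle_trans; [apply nrm_lin_le|]. rewrite Rabs_R1; lra.
Qed.

(** * Quadratic forms *)

Definition qf (d : nat) (A : nat -> nat -> R) (u v : Pt) : R :=
  rsum d (fun i => rsum d (fun j => A i j * u i * v j)).

Lemma qf_lin_l (d : nat) (A : nat -> nat -> R) (a b : R) (u v w : Pt) :
  qf d A (lin a u b v) w = a * qf d A u w + b * qf d A v w.
Proof.
  unfold qf, lin. rewrite <- !rsum_scal, <- rsum_plus. apply rsum_ext; intros i _.
  rewrite <- !rsum_scal, <- rsum_plus. apply rsum_ext; intros; ring.
Qed.

Lemma qf_lin_r (d : nat) (A : nat -> nat -> R) (a b : R) (u v w : Pt) :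
  qf d A w (lin a u b v) = a * qf d A w u + b * qf d A w v.
Proof.
  unfold qf, lin. rewrite <- !rsum_scal, <- rsum_plus. apply rsum_ext; intros i _.
  rewrite <- !rsum_scal, <- rsum_plus. apply rsum_ext; intros; ring.
Qed.

Lemma qf_ext (d : nat) (A A' : nat -> nat -> R) (u u' v v' : Pt) :
  (forall i j, (i < d)%nat -> (j < d)%nat -> A i j = A' i j) ->
  (forall i, (i < d)%nat -> u i = u' i) -> (forall i, (i < d)%nat -> v i = v' i) ->
  qf d A u v = qf d A' u' v'.
Proof.
  intros HA Hu Hv. apply rsum_ext; intros i Hi. apply rsum_ext; intros j Hj.
  now rewrite HA, Hu, Hv.
Qed.

Lemma qf_minus (d : nat) (A A' : nat -> nat -> R) (u v : Pt) :
  qf d (fun i j => A i j - A' i j) u v = qf d A u v - qf d A' u v.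
Proof.
  unfold qf. rewrite <- rsum_minus. apply rsum_ext; intros i _.
  rewrite <- rsum_minus. apply rsum_ext; intros; ring.
Qed.

(** The matrix has the shape of the Hessian of a composition F(f), with a = F'(f), b = F''(f) and g
    the gradient of f. *)
Lemma qf_rank_one (d : nat) (a b : R) (A : nat -> nat -> R) (g u : Pt) :
  qf d (fun i j => a * A i j + b * (g i * g j)) u u =
  a * qf d A u u + b * (dot d g u * dot d g u).
Proof.
  unfold qf. replace (dot d g u * dot d g u)
    with (rsum d (fun i => rsum d (fun j => (g i * g j) * u i * u j))).
  - rewrite <- !rsum_scal, <- rsum_plus. apply rsum_ext; intros i _.
    rewrite <- !rsum_scal, <- rsum_plus. apply rsum_ext; intros; ring.
  - unfold dot at 1. rewrite Rmult_comm, <- rsum_scal. apply rsum_ext; intros i _.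
    rewrite Rmult_comm. unfold dot. rewrite <- rsum_scal. apply rsum_ext; intros; ring.
Qed.

Lemma qf_bound (d : nat) (A : nat -> nat -> R) (a : R) (u v : Pt) :
  (forall i j, (i < d)%nat -> (j < d)%nat -> Rabs (A i j) <= a) -> 0 <= a ->
  Rabs (qf d A u v) <= a * (INR d * INR d) * (nrm d u * nrm d v).
Proof.
  intros H Ha. unfold qf. eapply Rle_trans; [apply rsum_Rabs|].
  apply Rle_trans with (rsum d (fun i => a * (INR d * nrm d v) * Rabs (u i))).
  - apply rsum_le; intros i Hi. eapply Rle_trans; [apply rsum_Rabs|].
    apply Rle_trans with (rsum d (fun j => a * Rabs (u i) * Rabs (v j))).
    + apply rsum_le; intros j Hj. rewrite !Rabs_mult.
      apply Rmult_le_compat_r; [apply Rabs_pos|].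
      apply Rmult_le_compat_r; [apply Rabs_pos|]. auto.
    + rewrite rsum_scal.
      replace (a * (INR d * nrm d v) * Rabs (u i))
        with (a * Rabs (u i) * (INR d * nrm d v)) by ring.
      apply Rmult_le_compat_l; [|apply rsum_Rabs_le_nrm].
      apply Rmult_le_pos; [assumption|apply Rabs_pos].
  - rewrite rsum_scal.
    replace (a * (INR d * INR d) * (nrm d u * nrm d v))
      with (a * (INR d * nrm d v) * (INR d * nrm d u)) by ring.
    apply Rmult_le_compat_l; [|apply rsum_Rabs_le_nrm].
    apply Rmult_le_pos; [assumption|].
    apply Rmult_le_pos; [apply pos_INR|apply nrm_nonneg].
Qed.

(** * Partial derivatives *)

Lemma upd_0 (x : Pt) (i : nat) : upd x i 0 = x.
Proof.
  apply functional_extensionality; intro k. unfold upd. destruct (Nat.eqb k i); ring.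
Qed.

Lemma upd_upd (x : Pt) (i : nat) (a b : R) : upd (upd x i a) i b = upd x i (a + b).
Proof.
  apply functional_extensionality; intro k. unfold upd. destruct (Nat.eqb k i); ring.
Qed.

Lemma inRd_upd (d i : nat) (x : Pt) (h : R) : (i < d)%nat -> inRd d x -> inRd d (upd x i h).
Proof.
  intros Hi Hx k Hk. unfold upd. destruct (Nat.eqb_spec k i); [lia|auto].
Qed.

Lemma rsum_single (k i : nat) (a : R) :
  rsum k (fun j => if Nat.eqb j i then a else 0) = if Nat.ltb i k then a else 0.
Proof.
  induction k as [|k IH]; [reflexivity|]. simpl rsum. rewrite IH.
  destruct (Nat.eqb_spec k i); destruct (Nat.ltb_spec i k);
    destruct (Nat.ltb_spec i (S k)); try lia; ring.
Qed.

Lemma distRd_upd (d i : nat) (x : Pt) (h : R) : distRd d x (upd x i h) <= Rabs h.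
Proof.
  rewrite distRd_nrm. apply le_of_sqr_le; [apply Rabs_pos|].
  rewrite nrm_sqr, <- Rabs_mult, Rabs_pos_eq by nra. unfold dot.
  rewrite (rsum_ext d _ (fun j => if Nat.eqb j i then h * h else 0)).
  - rewrite rsum_single. destruct (Nat.ltb i d); nra.
  - intros j _. unfold psub, upd. destruct (Nat.eqb j i); ring.
Qed.

(** Gives access to the one-variable rules for sums, products and compositions. *)
Lemma has_partial_deriv (i : nat) (f : Pt -> R) (x : Pt) (l : R) :
  has_partial i f x l <-> derivable_pt_lim (fun h => f (upd x i h)) 0 l.
Proof.
  split.
  - intros H eps He. destruct (H eps He) as [del [Hd Hdel]].
    exists (mkposreal del Hd). intros h Hh Hlt. rewrite Rplus_0_l, upd_0. now apply Hdel.
  - intros H eps He. destruct (H eps He) as [[del Hd] Hdel].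
    exists del; split; [exact Hd|]. intros h Hh Hlt.
    specialize (Hdel h Hh Hlt). now rewrite Rplus_0_l, upd_0 in Hdel.
Qed.

Lemma has_partial_unique (i : nat) (f : Pt -> R) (x : Pt) (l : R) :
  has_partial i f x l -> pd i f x = l.
Proof.
  intros H. unfold pd.
  pose proof (epsilon_spec (inhabits 0) (has_partial i f x) (ex_intro _ l H)) as H'.
  apply has_partial_deriv in H. apply has_partial_deriv in H'.
  exact (uniqueness_limite _ _ _ _ H' H).
Qed.

Lemma has_partial_pd (i : nat) (f : Pt -> R) (x : Pt) :
  (exists l, has_partial i f x l) -> has_partial i f x (pd i f x).
Proof. intros [l H]. now rewrite (has_partial_unique _ _ _ _ H). Qed.

Lemma has_partial_local (d i : nat) (W : Pt -> Prop) (f g : Pt -> R) (x : Pt) (l : R) :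
  openRd d W -> W x -> (i < d)%nat -> (forall y, W y -> f y = g y) ->
  has_partial i f x l -> has_partial i g x l.
Proof.
  intros [HW1 HW2] Hx Hi E H eps He.
  destruct (H eps He) as [d1 [Hd1 H1]]. destruct (HW2 x Hx) as [d2 [Hd2 H2]].
  exists (Rmin d1 d2); split; [now apply Rmin_pos|]. intros h Hh Hlt.
  rewrite <- E, <- E; [|assumption|].
  - apply H1; [assumption|]. eapply Rlt_le_trans; [exact Hlt|apply Rmin_l].
  - apply H2; [apply inRd_upd; auto|].
    eapply Rle_lt_trans; [apply distRd_upd|].
    eapply Rlt_le_trans; [exact Hlt|apply Rmin_r].
Qed.

Lemma pd_local (d i : nat) (W : Pt -> Prop) (f g : Pt -> R) (x : Pt) :
  openRd d W -> W x -> (i < d)%nat -> (forall y, W y -> f y = g y) ->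
  pd i f x = pd i g x.
Proof.
  intros HW Hx Hi E.
  destruct (classic (exists l, has_partial i f x l)) as [[l H]|N].
  - rewrite (has_partial_unique _ _ _ _ H). symmetry. apply has_partial_unique.
    eapply has_partial_local; eauto.
  (* Here neither function has a partial derivative, and both values of [pd] are arbitrary choices
     made by [epsilon]. They agree because the two predicates are equal. *)
  - unfold pd. f_equal. apply functional_extensionality; intro l.
    apply propositional_extensionality; split; intros H.
    + eapply has_partial_local; eauto.
    + eapply has_partial_local with (f := g); eauto. intros; symmetry; auto.
Qed.

Lemma continuous_on_local (d : nat) (V : Pt -> Prop) (f : Pt -> R) :
  (forall x, V x -> exists W g, openRd d W /\ W x /\
     (forall y, W y -> f y = g y) /\ continuous_on d W g) ->
  continuous_on d V f.
Proof.
  intros H x Vx eps He. destruct (H x Vx) as (W & g & [HW1 HW2] & Wx & E & Hg).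
  destruct (Hg x Wx eps He) as [d1 [Hd1 H1]]. destruct (HW2 x Wx) as [d2 [Hd2 H2]].
  exists (Rmin d1 d2); split; [now apply Rmin_pos|]. intros y Hy _ Hxy.
  assert (W y) by (apply H2; auto; eapply Rlt_le_trans; [exact Hxy|apply Rmin_r]).
  rewrite !E by assumption. apply H1; auto.
  eapply Rlt_le_trans; [exact Hxy|apply Rmin_l].
Qed.

(** The model [g] may change from point to point, which is what a function glued from two formulas
    requires. The induction works because [pd] depends only on the germ of a function. *)
Lemma Cm_local (d m : nat) (V : Pt -> Prop) (f : Pt -> R) :
  (forall x, V x -> exists W g, openRd d W /\ W x /\
     (forall y, W y -> f y = g y) /\ Cm d m W g) ->
  Cm d m V f.
Proof.
  revert f. induction m as [|m IH]; intros f H; [now apply continuous_on_local|].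
  split; [|intros i Hi; split].
  - apply continuous_on_local. intros x Vx.
    destruct (H x Vx) as (W & g & HW & Wx & E & [Hg _]). now exists W, g.
  - intros x Vx. destruct (H x Vx) as (W & g & HW & Wx & E & [_ Hg]).
    destruct (Hg i Hi) as [Hp _]. destruct (Hp x Wx) as [l Hl]. exists l.
    eapply has_partial_local with (f := g); eauto. intros; symmetry; auto.
  - apply IH. intros x Vx. destruct (H x Vx) as (W & g & HW & Wx & E & [_ Hg]).
    exists W, (pd i g). repeat split; try apply HW; auto.
    + intros y Wy. eapply pd_local; eauto.
    + now apply Hg.
Qed.

Lemma Cm_ext (d m : nat) (U : Pt -> Prop) (f g : Pt -> R) :
  openRd d U -> (forall x, U x -> f x = g x) -> Cm d m U g -> Cm d m U f.
Proof. intros HU E H. apply Cm_local. intros x Ux. exists U, g. auto. Qed.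

Lemma Cm_subset (d m : nat) (U V : Pt -> Prop) (f : Pt -> R) :
  (forall x, V x -> U x) -> Cm d m U f -> Cm d m V f.
Proof.
  revert f. induction m as [|m IH]; intros f S.
  - intros H x Vx eps He. destruct (H x (S x Vx) eps He) as [del [Hd Hdel]].
    exists del; split; auto.
  - intros [H0 H1]; split.
    + intros x Vx eps He. destruct (H0 x (S x Vx) eps He) as [del [Hd Hdel]].
      exists del; split; auto.
    + intros i Hi. destruct (H1 i Hi) as [Hp Hc]. split; auto.
Qed.

Lemma Cm_continuous (d m : nat) (U : Pt -> Prop) (f : Pt -> R) :
  Cm d m U f -> continuous_on d U f.
Proof. destruct m; [auto|intros [H _]; exact H]. Qed.

Lemma Cm_pred (d m : nat) (U : Pt -> Prop) (f : Pt -> R) : Cm d (S m) U f -> Cm d m U f.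
Proof.
  revert f. induction m as [|m IH]; intros f [H0 H1]; [exact H0|].
  split; [exact H0|]. intros i Hi. destruct (H1 i Hi). split; auto.
Qed.

Lemma Cm_pd (d m i : nat) (U : Pt -> Prop) (f : Pt -> R) :
  (i < d)%nat -> Cm d (S m) U f -> Cm d m U (pd i f).
Proof. intros Hi [_ H]. now apply H. Qed.

Lemma Cm_has_partial (d m i : nat) (U : Pt -> Prop) (f : Pt -> R) (x : Pt) :
  (i < d)%nat -> Cm d (S m) U f -> U x -> has_partial i f x (pd i f x).
Proof. intros Hi [_ H] Ux. apply has_partial_pd. now apply (H i Hi). Qed.

Lemma continuous_on_plus (d : nat) (U : Pt -> Prop) (f g : Pt -> R) :
  continuous_on d U f -> continuous_on d U g -> continuous_on d U (fun x => f x + g x).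
Proof.
  intros Hf Hg x Ux eps He.
  destruct (Hf x Ux (eps / 2) ltac:(lra)) as [d1 [Hd1 H1]].
  destruct (Hg x Ux (eps / 2) ltac:(lra)) as [d2 [Hd2 H2]].
  exists (Rmin d1 d2); split; [now apply Rmin_pos|]. intros y Hy Uy Hxy.
  pose proof (Rmin_l d1 d2). pose proof (Rmin_r d1 d2).
  specialize (H1 y Hy Uy ltac:(lra)). specialize (H2 y Hy Uy ltac:(lra)).
  replace (f y + g y - (f x + g x)) with ((f y - f x) + (g y - g x)) by ring.
  eapply Rle_lt_trans; [apply Rabs_triang|]. lra.
Qed.

Lemma continuous_on_mult (d : nat) (U : Pt -> Prop) (f g : Pt -> R) :
  continuous_on d U f -> continuous_on d U g -> continuous_on d U (fun x => f x * g x).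
Proof.
  intros Hf Hg x Ux eps He.
  (* When both increments are below e <= 1, their product is below e, so the three terms of the
     expansion add up to less than e * M. *)
  set (M := 1 + Rabs (f x) + Rabs (g x)).
  pose proof (Rabs_pos (f x)) as Pf. pose proof (Rabs_pos (g x)) as Pg.
  assert (HM : 0 < M) by (unfold M; lra).
  set (e := Rmin 1 (eps / M)).
  assert (He' : 0 < e) by (apply Rmin_pos; [lra|now apply Rdiv_lt_0_compat]).
  destruct (Hf x Ux e He') as [d1 [Hd1 H1]].
  destruct (Hg x Ux e He') as [d2 [Hd2 H2]].
  exists (Rmin d1 d2); split; [now apply Rmin_pos|]. intros y Hy Uy Hxy.
  pose proof (Rmin_l d1 d2). pose proof (Rmin_r d1 d2).
  specialize (H1 y Hy Uy ltac:(lra)). specialize (H2 y Hy Uy ltac:(lra)).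
  replace (f y * g y - f x * g x)
    with ((f y - f x) * (g y - g x) + f x * (g y - g x) + g x * (f y - f x)) by ring.
  assert (Hle : e <= 1) by apply Rmin_l.
  assert (HeM : e * M <= eps).
  { apply Rle_trans with (eps / M * M); [apply Rmult_le_compat_r; [lra|apply Rmin_r]|].
    right; field; lra. }
  eapply Rle_lt_trans; [apply Rabs_triang|].
  eapply Rle_lt_trans; [apply Rplus_le_compat_r, Rabs_triang|].
  rewrite !Rabs_mult.
  pose proof (Rabs_pos (f y - f x)). pose proof (Rabs_pos (g y - g x)).
  unfold M in HeM. nra.
Qed.

Lemma continuous_on_comp (d : nat) (U : Pt -> Prop) (f : Pt -> R) (F : R -> R) :
  continuity F -> continuous_on d U f -> continuous_on d U (fun x => F (f x)).
Proof.
  intros HF Hf x Ux eps He.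
  destruct (HF (f x) eps He) as [e [He' HFe]].
  destruct (Hf x Ux e He') as [del [Hd Hdel]].
  exists del; split; [exact Hd|]. intros y Hy Uy Hxy.
  (* The limit in [continuity] is over points distinct from [f x], so equality is treated apart. *)
  destruct (Req_dec (f y) (f x)) as [->|Hne]; [rewrite Rminus_diag, Rabs_R0; exact He|].
  apply (HFe (f y)). split; [split; [exact I|auto]|]. now apply Hdel.
Qed.

Lemma has_partial_const (i : nat) (c : R) (x : Pt) : has_partial i (fun _ => c) x 0.
Proof.
  intros eps He. exists 1; split; [lra|]. intros h Hh _.
  replace ((c - c) / h - 0) with 0 by (field; assumption). now rewrite Rabs_R0.
Qed.

Lemma pd_const (i : nat) (c : R) : pd i (fun _ => c) = fun _ => 0.
Proof.
  apply functional_extensionality; intro x. apply has_partial_unique, has_partial_const.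
Qed.

Lemma Cm_const (d m : nat) (U : Pt -> Prop) (c : R) : Cm d m U (fun _ => c).
Proof.
  assert (C : forall c, continuous_on d U (fun _ => c)).
  { intros b x _ eps He. exists 1; split; [lra|]. intros. now rewrite Rminus_diag, Rabs_R0. }
  revert c. induction m as [|m IH]; intros c; [apply C|].
  split; [apply C|]. intros i Hi. split.
  - intros x _. exists 0. apply has_partial_const.
  - rewrite pd_const. apply IH.
Qed.

Lemma has_partial_comp (G : R -> R) (i : nat) (g : Pt -> R) (x : Pt) (l k : R) :
  derivable_pt_lim G (g x) k -> has_partial i g x l ->
  has_partial i (fun y => G (g y)) x (k * l).
Proof.
  rewrite !has_partial_deriv. intros HG Hg.
  apply (derivable_pt_lim_comp (fun h => g (upd x i h)) G); [exact Hg|].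
  now rewrite upd_0.
Qed.

Lemma has_partial_mult (i : nat) (f g : Pt -> R) (x : Pt) (k l : R) :
  has_partial i f x k -> has_partial i g x l ->
  has_partial i (fun y => f y * g y) x (k * g x + f x * l).
Proof.
  rewrite !has_partial_deriv. intros Hf Hg.
  pose proof (derivable_pt_lim_mult _ _ _ _ _ Hf Hg) as H. cbv beta in H.
  rewrite upd_0 in H. exact H.
Qed.

(** * Chain rule up to order two for a one-variable function of f *)

Section Composition.

Variables (d : nat) (U : Pt -> Prop) (f : Pt -> R) (F F1 F2 : R -> R).
Hypothesis HU : openRd d U.
Hypothesis HF : forall s, derivable_pt_lim F s (F1 s).
Hypothesis HF1 : forall s, derivable_pt_lim F1 s (F2 s).
Hypothesis HF2 : continuity F2.
Hypothesis Hf : Cm d 2 U f.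

Let continuity_of_derivable (G G' : R -> R) :
  (forall s, derivable_pt_lim G s (G' s)) -> continuity G.
Proof. intros H s. apply derivable_continuous_pt. exists (G' s). apply H. Qed.

Lemma pd_comp (i : nat) (x : Pt) : (i < d)%nat -> U x ->
  pd i (fun y => F (f y)) x = F1 (f x) * pd i f x.
Proof.
  intros Hi Ux. apply has_partial_unique. apply has_partial_comp; [apply HF|].
  eapply Cm_has_partial; eauto.
Qed.

Let has_partial_pd_comp (i j : nat) (x : Pt) : (i < d)%nat -> (j < d)%nat -> U x ->
  has_partial i (fun y => F1 (f y) * pd j f y) x
    (F2 (f x) * pd i f x * pd j f x + F1 (f x) * pd i (pd j f) x).
Proof.
  intros Hi Hj Ux. apply has_partial_mult.
  - apply has_partial_comp; [apply HF1|]. eapply Cm_has_partial; eauto.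
  - apply Cm_has_partial with (d := d) (m := 0%nat) (U := U); [exact Hi| |exact Ux].
    now apply Cm_pd.
Qed.

Lemma pd_pd_comp (i j : nat) (x : Pt) : (i < d)%nat -> (j < d)%nat -> U x ->
  pd i (pd j (fun y => F (f y))) x =
  F1 (f x) * pd i (pd j f) x + F2 (f x) * (pd i f x * pd j f x).
Proof.
  intros Hi Hj Ux.
  rewrite (pd_local d i U _ (fun y => F1 (f y) * pd j f y) x HU Ux Hi).
  - rewrite (has_partial_unique _ _ _ _ (has_partial_pd_comp i j x Hi Hj Ux)). ring.
  - intros; now apply pd_comp.
Qed.

Lemma Cm_comp : Cm d 2 U (fun y => F (f y)).
Proof.
  assert (C1 : forall j, (j < d)%nat -> continuous_on d U (pd j f))
    by (intros j Hj; apply (Cm_continuous d 1), Cm_pd; assumption).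
  assert (C2 : forall i j, (i < d)%nat -> (j < d)%nat -> continuous_on d U (pd i (pd j f)))
    by (intros i j Hi Hj; apply (Cm_continuous d 0), Cm_pd, Cm_pd; assumption).
  assert (C0 : continuous_on d U f) by (eapply Cm_continuous; eauto).
  assert (KF1 : continuity F1) by (eapply continuity_of_derivable; eauto).
  split; [|intros j Hj; split].
  - apply continuous_on_comp; [|assumption]. eapply continuity_of_derivable; eauto.
  - intros x Ux. eexists. apply has_partial_comp; [apply HF|].
    eapply Cm_has_partial; eauto.
  - apply (Cm_ext d 1 U _ (fun y => F1 (f y) * pd j f y)); [assumption| |].
    + intros; now apply pd_comp.
    + split; [|intros i Hi; split].
      * apply continuous_on_mult; [now apply continuous_on_comp|auto].
      * intros x Ux. eexists. now apply has_partial_pd_comp.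
      * apply (Cm_ext d 0 U _ (fun x => F2 (f x) * pd i f x * pd j f x + F1 (f x) * pd i (pd j f) x));
          [assumption| |].
        -- intros x Ux. apply has_partial_unique. now apply has_partial_pd_comp.
        -- apply continuous_on_plus; apply continuous_on_mult; auto;
             [apply continuous_on_mult; auto|]; now apply continuous_on_comp.
Qed.

End Composition.

(** * Mean value and Taylor formulas *)

Lemma inRd_lin (d : nat) (a b : R) (u v : Pt) : inRd d u -> inRd d v -> inRd d (lin a u b v).
Proof. intros Hu Hv i Hi. unfold lin. rewrite Hu, Hv by assumption. ring. Qed.

Lemma distRd_le_coord (d : nat) (x y z : Pt) :
  (forall i, (i < d)%nat -> Rabs (x i - z i) <= Rabs (x i - y i)) ->
  distRd d x z <= distRd d x y.
Proof. intros H. rewrite !distRd_nrm. now apply nrm_le_coord. Qed.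

(* Change the coordinates of [x] into those of [y] one at a time. *)
Lemma mvt_partials (d : nat) (U : Pt -> Prop) (f : Pt -> R) (x y : Pt) :
  Cm d 1 U f -> inRd d x -> inRd d y ->
  (forall z, inRd d z -> distRd d x z <= distRd d x y -> U z) ->
  exists xi : nat -> Pt,
    (forall k, (k < d)%nat -> inRd d (xi k) /\ distRd d x (xi k) <= distRd d x y) /\
    f y - f x = rsum d (fun k => pd k f (xi k) * (y k - x k)).
Proof.
  intros Hf Hx Hy HU.
  (* Only partial derivatives are available so far; differentiability along segments is itself
     deduced from this lemma. The path from x to y therefore runs parallel to the axes, with corners
     [w m]. *)
  set (w := fun m : nat => fun i => if Nat.ltb i m then y i else x i).
  assert (K : forall m, (m <= d)%nat -> exists xi : nat -> Pt,
    (forall k, (k < m)%nat -> inRd d (xi k) /\ distRd d x (xi k) <= distRd d x y) /\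
    f (w m) - f x = rsum m (fun k => pd k f (xi k) * (y k - x k))).
  { induction m as [|m IH]; intros Hm.
    - exists (fun _ => x). split; [intros; lia|]. simpl.
      replace (w O) with x; [ring|]. apply functional_extensionality; intro i. reflexivity.
    - destruct IH as [xi [H1 H2]]; [lia|].
      assert (Hwm : inRd d (w m)).
      { intros i Hi. unfold w. destruct (Nat.ltb_spec i m); [lia|auto]. }
      (* Every coordinate on the path lies between those of x and y, so the path never leaves the
         closed ball around x through y. *)
      assert (Dw : forall h, Rmin 0 (y m - x m) <= h <= Rmax 0 (y m - x m) ->
        inRd d (upd (w m) m h) /\ distRd d x (upd (w m) m h) <= distRd d x y).
      { intros h Hh. split; [apply inRd_upd; [lia|assumption]|].
        apply distRd_le_coord. intros i Hi. unfold upd, w.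
        destruct (Nat.eqb_spec i m) as [->|Hne].
        - rewrite Nat.ltb_irrefl. unfold Rmin, Rmax in Hh.
          destruct (Rle_dec 0 (y m - x m)); unfold Rabs; repeat destruct Rcase_abs; lra.
        - destruct (Nat.ltb i m); [lra|]. rewrite Rminus_diag, Rabs_R0. apply Rabs_pos. }
      assert (Der : forall h, Rmin 0 (y m - x m) <= h <= Rmax 0 (y m - x m) ->
        is_derive (fun h => f (upd (w m) m h)) h (pd m f (upd (w m) m h))).
      { intros h Hh. destruct (Dw h Hh) as [D1 D2].
        assert (Hp : has_partial m f (upd (w m) m h) (pd m f (upd (w m) m h)))
          by (eapply Cm_has_partial with (d := d); [lia|exact Hf|auto]).
        apply is_derive_Reals. apply has_partial_deriv in Hp.
        intros eps He. destruct (Hp eps He) as [del Hdel]. exists del. intros k Hk Hlt.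
        specialize (Hdel k Hk Hlt). now rewrite Rplus_0_l, !upd_upd, Rplus_0_r in Hdel. }
      destruct (MVT_gen (fun h => f (upd (w m) m h)) 0 (y m - x m)
                 (fun h => pd m f (upd (w m) m h))) as [c [Hc Ec]].
      + intros h Hh. apply Der. lra.
      + intros h Hh. apply derivable_continuous_pt. eexists.
        apply is_derive_Reals. now apply Der.
      + exists (fun k => if Nat.eqb k m then upd (w m) m c else xi k). split.
        * intros k Hk. destruct (Nat.eqb_spec k m); [now apply Dw|]. apply H1; lia.
        * simpl. rewrite Nat.eqb_refl.
          rewrite (rsum_ext m _ (fun k => pd k f (xi k) * (y k - x k))).
          -- rewrite <- H2. replace (w (S m)) with (upd (w m) m (y m - x m)).
             ++ rewrite upd_0 in Ec. lra.
             ++ apply functional_extensionality; intro i. unfold upd, w.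
                destruct (Nat.eqb_spec i m) as [->|Hne]; [rewrite Nat.ltb_irrefl|];
                  [destruct (Nat.ltb_spec m (S m)) as [_|]; [ring|lia]|].
                destruct (Nat.ltb_spec i (S m)); destruct (Nat.ltb_spec i m); try lia; reflexivity.
          -- intros k Hk. destruct (Nat.eqb_spec k m); [lia|reflexivity]. }
  destruct (K d (le_n d)) as [xi [H1 H2]]. exists xi; split; [exact H1|].
  replace y with (w d) at 1; [exact H2|].
  apply functional_extensionality; intro i. unfold w.
  destruct (Nat.ltb_spec i d); [reflexivity|]. now rewrite Hx, Hy.
Qed.

Lemma lipschitz_of_partials (d : nat) (U : Pt -> Prop) (f : Pt -> R) (M : R) (x y : Pt) :
  Cm d 1 U f -> (forall i z, (i < d)%nat -> U z -> Rabs (pd i f z) <= M) -> 0 <= M ->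
  inRd d x -> inRd d y ->
  (forall z, inRd d z -> distRd d x z <= distRd d x y -> U z) ->
  Rabs (f y - f x) <= M * INR d * distRd d x y.
Proof.
  intros Hf HM M0 Hx Hy HU.
  destruct (mvt_partials d U f x y Hf Hx Hy HU) as [xi [H1 ->]].
  eapply Rle_trans; [apply rsum_Rabs|].
  apply Rle_trans with (rsum d (fun k => M * Rabs (psub y x k))).
  - apply rsum_le; intros k Hk. rewrite Rabs_mult.
    apply Rmult_le_compat_r; [apply Rabs_pos|]. apply HM; [exact Hk|].
    apply HU; now apply H1.
  - rewrite rsum_scal, Rmult_assoc. apply Rmult_le_compat_l; [exact M0|].
    rewrite distRd_sym, distRd_nrm. apply rsum_Rabs_le_nrm.
Qed.

Definition grad (f : Pt -> R) (x : Pt) : Pt := fun i => pd i f x.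
Definition hess (f : Pt -> R) (x : Pt) (i j : nat) : R := pd i (pd j f) x.

Lemma continuous_on_uniform (d m : nat) (U : Pt -> Prop) (g : nat -> Pt -> R) (x : Pt) (eps : R) :
  (forall i, (i < m)%nat -> continuous_on d U (g i)) -> U x -> 0 < eps ->
  exists delta, 0 < delta /\ forall i y, (i < m)%nat -> inRd d y -> U y ->
    distRd d x y < delta -> Rabs (g i y - g i x) < eps.
Proof.
  intros H Ux He. induction m as [|m IH].
  - exists 1; split; [lra|]. intros; lia.
  - destruct IH as [d1 [Hd1 H1]]; [auto|].
    destruct (H m (Nat.lt_succ_diag_r m) x Ux eps He) as [d2 [Hd2 H2]].
    exists (Rmin d1 d2); split; [now apply Rmin_pos|]. intros i y Hi Hy Uy Hxy.
    pose proof (Rmin_l d1 d2). pose proof (Rmin_r d1 d2).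
    destruct (Nat.eq_dec i m) as [->|Hne]; [apply H2|apply H1]; auto; try lia; lra.
Qed.

Lemma distRd_lin (d : nat) (x u : Pt) (t : R) :
  distRd d x (lin 1 x t u) = Rabs t * nrm d u.
Proof.
  rewrite distRd_nrm, <- (Rabs_Ropp t), <- nrm_scal.
  apply nrm_ext. intros; unfold psub, lin; ring.
Qed.

(** Continuity of the partial derivatives is essential here: the mean value points [xi k] differ
    from x, and the partials there must be compared with those at x. *)
Lemma derive_line_0 (d : nat) (U : Pt -> Prop) (f : Pt -> R) (x u : Pt) :
  openRd d U -> Cm d 1 U f -> U x -> inRd d u ->
  derivable_pt_lim (fun t => f (lin 1 x t u)) 0 (dot d (grad f x) u).
Proof.
  intros [HU1 HU2] Hf Ux Hu eps He.
  (* The error is at most eps / N times d |u|; adding 1 to each factor keeps N positive and the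
     final inequality strict, also when d = 0 or u = 0. *)
  set (N := (INR d + 1) * (nrm d u + 1)).
  pose proof (pos_INR d) as Pd. pose proof (nrm_nonneg d u) as Pu.
  assert (HN : 0 < N) by (unfold N; nra).
  destruct (HU2 x Ux) as [d1 [Hd1 H1]].
  destruct (continuous_on_uniform d d U (fun i => pd i f) x (eps / N)) as [d2 [Hd2 H2]];
    [|exact Ux|now apply Rdiv_lt_0_compat|].
  { intros i Hi. apply (Cm_continuous d 0). now apply Cm_pd. }
  assert (Hdel : 0 < Rmin d1 d2 / N)
    by (apply Rdiv_lt_0_compat; [now apply Rmin_pos|assumption]).
  exists (mkposreal _ Hdel). simpl. intros h Hh Hlt. rewrite Rplus_0_l.
  replace (lin 1 x 0 u) with x
    by (apply functional_extensionality; intro; unfold lin; ring).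
  assert (Dist : distRd d x (lin 1 x h u) < Rmin d1 d2).
  { rewrite distRd_lin. apply Rle_lt_trans with (Rabs h * N).
    - apply Rmult_le_compat_l; [apply Rabs_pos|]. unfold N. nra.
    - apply Rmult_lt_compat_r with (r := N) in Hlt; [|assumption].
      replace (Rmin d1 d2 / N * N) with (Rmin d1 d2) in Hlt by (field; lra). exact Hlt. }
  pose proof (Rmin_l d1 d2). pose proof (Rmin_r d1 d2).
  destruct (mvt_partials d U f x (lin 1 x h u)) as [xi [X1 X2]]; auto.
  { apply inRd_lin; auto. }
  { intros z Hz Dz. apply H1; [assumption|lra]. }
  rewrite X2.
  replace (_ - _) with (rsum d (fun k => (pd k f (xi k) - pd k f x) * u k)).
  - eapply Rle_lt_trans; [apply rsum_Rabs|].
    apply Rle_lt_trans with (rsum d (fun k => eps / N * Rabs (u k))).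
    + apply rsum_le; intros k Hk. rewrite Rabs_mult.
      apply Rmult_le_compat_r; [apply Rabs_pos|]. destruct (X1 k Hk).
      left. apply H2; auto; [apply H1; auto|]; lra.
    + rewrite rsum_scal.
      apply Rle_lt_trans with (eps / N * (INR d * nrm d u)).
      * apply Rmult_le_compat_l; [|apply rsum_Rabs_le_nrm].
        left; now apply Rdiv_lt_0_compat.
      * apply Rlt_le_trans with (eps / N * N); [|right; field; lra].
        apply Rmult_lt_compat_l; [now apply Rdiv_lt_0_compat|]. unfold N; nra.
  - unfold dot, grad, lin. unfold Rdiv. rewrite Rmult_comm, <- rsum_scal, <- rsum_minus.
    apply rsum_ext; intros k Hk. field. assumption.
Qed.

Lemma derive_line (d : nat) (U : Pt -> Prop) (f : Pt -> R) (x u : Pt) (t : R) :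
  openRd d U -> Cm d 1 U f -> U (lin 1 x t u) -> inRd d u ->
  derivable_pt_lim (fun s => f (lin 1 x s u)) t (dot d (grad f (lin 1 x t u)) u).
Proof.
  intros HU Hf Ut Hu eps He.
  destruct (derive_line_0 d U f _ u HU Hf Ut Hu eps He) as [del Hdel].
  exists del. intros h Hh Hlt. specialize (Hdel h Hh Hlt). rewrite Rplus_0_l in Hdel.
  assert (E : forall s, lin 1 (lin 1 x t u) s u = lin 1 x (t + s) u)
    by (intros s; apply functional_extensionality; intro; unfold lin; ring).
  now rewrite !E, Rplus_0_r in Hdel.
Qed.

Lemma derivable_rsum (k : nat) (f : nat -> R -> R) (l : nat -> R) (t : R) :
  (forall i, (i < k)%nat -> derivable_pt_lim (f i) t (l i)) ->
  derivable_pt_lim (fun s => rsum k (fun i => f i s)) t (rsum k l).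
Proof.
  induction k as [|k IH]; intros H; simpl; [apply derivable_pt_lim_const|].
  apply derivable_pt_lim_plus; auto.
Qed.

Lemma taylor_lagrange_2 (p p1 p2 : R -> R) :
  (forall t, 0 <= t <= 1 -> derivable_pt_lim p t (p1 t)) ->
  (forall t, 0 <= t <= 1 -> derivable_pt_lim p1 t (p2 t)) ->
  exists c, 0 <= c <= 1 /\ p 1 = p 0 + p1 0 + p2 c / 2.
Proof.
  intros H1 H2.
  (* This value gives p(t) + (1 - t) p1(t) + (1 - t)^2 a the same value at 0 and at 1. Its
     derivative is (1 - t) (p2(t) - 2 a), and the mean value point satisfies c < 1, so the factor 1
     - c cancels. *)
  set (a := p 1 - p 0 - p1 0).
  destruct (MVT_cor2 (fun t => p t + (1 - t) * p1 t + (1 - t) ^ 2 * a)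
             (fun t => (1 - t) * p2 t - 2 * (1 - t) * a) 0 1) as [c [Hc Hc']].
  - lra.
  - intros c Hc. specialize (H1 c Hc). specialize (H2 c Hc).
    apply is_derive_Reals in H1. apply is_derive_Reals in H2. apply is_derive_Reals.
    auto_derive; [repeat split; auto; eexists; eassumption|].
    replace (Derive (fun x => p x) c) with (p1 c) by (symmetry; now apply is_derive_unique).
    replace (Derive (fun x => p1 x) c) with (p2 c) by (symmetry; now apply is_derive_unique).
    ring.
  - exists c. split; [lra|]. unfold a in Hc. 
    assert (E : (1 - c) * (p2 c - 2 * a) = 0) by (unfold a in *; nra).
    apply Rmult_integral in E. unfold a in E. lra.
Qed.

Lemma taylor_2 (d : nat) (U : Pt -> Prop) (f : Pt -> R) (x u : Pt) :
  openRd d U -> Cm d 2 U f -> inRd d u ->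
  (forall t, 0 <= t <= 1 -> U (lin 1 x t u)) ->
  exists c, 0 <= c <= 1 /\
    f (lin 1 x 1 u) = f x + dot d (grad f x) u + qf d (hess f (lin 1 x c u)) u u / 2.
Proof.
  intros HU Hf Hu Hseg.
  destruct (taylor_lagrange_2 (fun t => f (lin 1 x t u))
    (fun t => dot d (grad f (lin 1 x t u)) u)
    (fun t => qf d (hess f (lin 1 x t u)) u u)) as [c [Hc E]].
  - intros t Ht. apply (derive_line d U); auto. now apply Cm_pred.
  - intros t Ht. unfold dot at 1.
    replace (qf d (hess f (lin 1 x t u)) u u)
      with (rsum d (fun j => u j * dot d (grad (pd j f) (lin 1 x t u)) u)).
    + apply derivable_rsum. intros j Hj.
      replace (fun s : R => grad f (lin 1 x s u) j * u j)
        with (mult_real_fct (u j) (fun s => pd j f (lin 1 x s u)))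
        by (apply functional_extensionality; intro; unfold mult_real_fct, grad; ring).
      apply derivable_pt_lim_scal. apply (derive_line d U); auto. now apply Cm_pd.
    + unfold qf. rewrite rsum_swap. apply rsum_ext; intros j Hj. unfold dot.
      rewrite <- rsum_scal. apply rsum_ext; intros i Hi. unfold hess, grad. ring.
  - exists c; split; [exact Hc|]. cbv beta in E. rewrite E.
    replace (lin 1 x 0 u) with x
      by (apply functional_extensionality; intro; unfold lin; ring). reflexivity.
Qed.

(** * Boundaries and defining functions *)

Lemma inRd_psub (d : nat) (x y : Pt) : inRd d x -> inRd d y -> inRd d (psub x y).
Proof. intros Hx Hy i Hi. unfold psub. rewrite Hx, Hy by assumption. ring. Qed.

Lemma segment_boundary (d : nat) (S : Pt -> Prop) (x y : Pt) :
  inRd d x -> inRd d y -> S x -> ~ S y ->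
  exists z, boundary d S z /\ distRd d x z <= distRd d x y.
Proof.
  intros Hx Hy Sx Ny.
  set (g := fun t => lin 1 x t (psub y x)).
  assert (Hg : forall t, inRd d (g t)) by (intro; apply inRd_lin; auto using inRd_psub).
  assert (g0 : g 0 = x)
    by (apply functional_extensionality; intro; unfold g, lin, psub; ring).
  assert (g1 : g 1 = y)
    by (apply functional_extensionality; intro; unfold g, lin, psub; ring).
  set (D := distRd d x y).
  assert (HD : 0 <= D) by apply distRd_nonneg.
  assert (Dg : forall s t, distRd d (g s) (g t) = Rabs (t - s) * D).
  { intros s t. unfold D. rewrite (distRd_sym d x y), !distRd_nrm.
    rewrite <- (Rabs_Ropp (t - s)), <- nrm_scal. apply nrm_ext.
    intros; unfold g, psub, lin; ring. }
  (* The boundary point sits at the supremum t of the parameters in S: such parameters accumulate at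
     t from below or equal t, and beyond t the segment is outside S. If t = 1, the endpoint y is the
     outside point. *)
  destruct (completeness (fun t => 0 <= t <= 1 /\ S (g t))) as [t [Ht1 Ht2]].
  - exists 1. intros t [Ht _]; lra.
  - exists 0. split; [lra|]. now rewrite g0.
  - assert (T0 : 0 <= t) by (apply Ht1; split; [lra|now rewrite g0]).
    assert (T1 : t <= 1) by (apply Ht2; intros s [Hs _]; lra).
    exists (g t). split; [split; [apply Hg|]|].
    + intros eps He.
      set (e := eps / (D + 1)).
      assert (He' : 0 < e) by (apply Rdiv_lt_0_compat; lra).
      assert (Close : forall s, Rabs (s - t) < e -> distRd d (g t) (g s) < eps).
      { intros s Hs. rewrite Dg. pose proof (Rabs_pos (s - t)).
        apply Rle_lt_trans with (Rabs (s - t) * (D + 1)); [nra|].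
        apply Rmult_lt_compat_r with (r := D + 1) in Hs; [|lra].
        replace (e * (D + 1)) with eps in Hs by (unfold e; field; lra). exact Hs. }
      split.
      * destruct (classic (exists s, t - e < s /\ 0 <= s <= 1 /\ S (g s)))
          as [[s [Hs [Hs' Ss]]]|N].
        -- exists (g s). split; [exact Ss|split; [apply Hg|apply Close]].
           assert (s <= t) by (apply Ht1; split; auto).
           apply Rabs_def1; lra.
        -- exfalso. assert (t <= t - e); [|lra]. apply Ht2. intros s [Hs Ss].
           destruct (Rle_or_lt s (t - e)); [assumption|]. exfalso; apply N; now exists s.
      * destruct (Rle_lt_dec 1 t) as [L|L].
        -- exists y. split; [exact Ny|split; [exact Hy|]]. rewrite <- g1. apply Close.
           replace t with 1 by lra. rewrite Rminus_diag, Rabs_R0. exact He'.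
        -- set (s := Rmin 1 (t + e / 2)).
           assert (t < s <= 1).
           { split; [apply Rmin_glb_lt; lra|apply Rmin_l]. }
           assert (s <= t + e / 2) by apply Rmin_r.
           exists (g s). split; [|split; [apply Hg|apply Close, Rabs_def1; lra]].
           intros Ss. assert (s <= t) by (apply Ht1; split; [lra|exact Ss]). lra.
    + rewrite <- g0 at 1. rewrite Dg, Rminus_0_r, Rabs_pos_eq by assumption. nra.
Qed.

Lemma boundary_open (d : nat) (S : Pt -> Prop) (p : Pt) :
  openRd d S -> boundary d S p -> ~ S p.
Proof.
  intros [_ HS] [_ Hp] Sp. destruct (HS p Sp) as [e [He H]].
  destruct (Hp e He) as [_ [y [Ny [Hy Dy]]]]. auto.
Qed.

(** A negative value would put p in Om, which is open and so misses its boundary; a positive value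
    would persist nearby, where there are points of Om. *)
Lemma defining_boundary_0 (d m : nat) (Om U : Pt -> Prop) (r : Pt -> R) (p : Pt) :
  openRd d Om -> is_defining d m Om U r -> boundary d Om p -> r p = 0.
Proof.
  intros HO (HU & HB & HC & HS & _) Hp.
  pose proof (HB p Hp) as Up.
  pose proof (boundary_open d Om p HO Hp) as Np.
  destruct (Rtotal_order (r p) 0) as [L|[E|L]]; [|exact E|]; exfalso.
  - now apply Np, HS.
  - destruct (Cm_continuous _ _ _ _ HC p Up (r p) L) as [d1 [Hd1 H1]].
    destruct HU as [_ HU]. destruct (HU p Up) as [d2 [Hd2 H2]].
    destruct Hp as [_ Hp]. destruct (Hp (Rmin d1 d2) ltac:(now apply Rmin_pos))
      as [[y [Oy [Hy Dy]]] _].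
    pose proof (Rmin_l d1 d2). pose proof (Rmin_r d1 d2).
    assert (Uy : U y) by (apply H2; auto; lra).
    specialize (H1 y Hy Uy ltac:(lra)). apply HS in Oy; [|exact Uy].
    apply Rabs_def2 in H1. lra.
Qed.

(** The entries of a gradient at indices >= d are uncontrolled, so it must be cut off before it can
    serve as a displacement in R^d. *)
Definition trunc (d : nat) (u : Pt) : Pt := fun i => if Nat.ltb i d then u i else 0.

Lemma inRd_trunc (d : nat) (u : Pt) : inRd d (trunc d u).
Proof. intros i Hi. unfold trunc. destruct (Nat.ltb_spec i d); [lia|reflexivity]. Qed.

Lemma trunc_lt (d i : nat) (u : Pt) : (i < d)%nat -> trunc d u i = u i.
Proof. intros Hi. unfold trunc. destruct (Nat.ltb_spec i d); [reflexivity|lia]. Qed.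

Lemma dot_ext (d : nat) (u u' v v' : Pt) :
  (forall i, (i < d)%nat -> u i = u' i) -> (forall i, (i < d)%nat -> v i = v' i) ->
  dot d u v = dot d u' v'.
Proof. intros Hu Hv. apply rsum_ext; intros. now rewrite Hu, Hv. Qed.

Lemma dot_trunc_r (d : nat) (u v : Pt) : dot d u (trunc d v) = dot d u v.
Proof. apply dot_ext; intros; [reflexivity|now apply trunc_lt]. Qed.

Lemma nrm_trunc (d : nat) (u : Pt) : nrm d (trunc d u) = nrm d u.
Proof. apply nrm_ext; intros; now apply trunc_lt. Qed.

Lemma dot_self_eq_0 (d i : nat) (u : Pt) : dot d u u = 0 -> (i < d)%nat -> u i = 0.
Proof.
  intros H Hi.
  pose proof (rsum_term_le d i (fun i => u i * u i) ltac:(intros; nra) Hi) as L.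
  fold (dot d u u) in L. nra.
Qed.

(** Let w be the component of b orthogonal to a. The vector -e a + w lies in the open half space for
    every e > 0, so -e <b, a> + |w|^2 <= 0, and letting e tend to 0 forces w = 0. *)
Lemma parallel_of_half_space (d : nat) (a b : Pt) :
  (forall v, inRd d v -> dot d a v < 0 -> dot d b v <= 0) ->
  dot d a a <> 0 -> dot d b b <> 0 ->
  exists h, 0 < h /\ forall i, (i < d)%nat -> b i = h * a i.
Proof.
  intros H Na Nb.
  pose proof (dot_self_nonneg d a) as Pa.
  set (h := dot d b a / dot d a a).
  set (w := lin 1 b (- h) a).
  assert (Haw : dot d a w = 0).
  { unfold w. rewrite dot_lin_r, (dot_comm d a b). unfold h. field. exact Na. }
  assert (Hbw : dot d b w = dot d w w).
  { unfold w at 2. rewrite dot_lin_l, Haw. ring. }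
  assert (Half : forall e, 0 < e -> - e * dot d b a + dot d w w <= 0).
  { intros e He. specialize (H (trunc d (lin (- e) a 1 w)) (inRd_trunc _ _)).
    rewrite !dot_trunc_r, !dot_lin_r, Haw, Hbw in H.
    rewrite <- (Rmult_1_l (dot d w w)). apply H. nra. }
  assert (Hw : dot d w w = 0).
  { pose proof (dot_self_nonneg d w) as Pw.
    destruct (Rle_lt_or_eq_dec _ _ Pw) as [L|E]; [exfalso|auto].
    (* Makes e |<b, a>| smaller than |w|^2 / 2, which contradicts [Half]. *)
    set (e := dot d w w / (2 * (Rabs (dot d b a) + 1))).
    pose proof (Rabs_pos (dot d b a)). pose proof (Rle_abs (dot d b a)).
    assert (He : 0 < e) by (apply Rdiv_lt_0_compat; lra).
    specialize (Half e He).
    assert (e * (2 * (Rabs (dot d b a) + 1)) = dot d w w) by (unfold e; field; lra).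
    nra. }
  assert (E : forall i, (i < d)%nat -> b i = h * a i).
  { intros i Hi. pose proof (dot_self_eq_0 d i w Hw Hi) as Z. unfold w, lin in Z. lra. }
  exists h; split; [|exact E].
  assert (Ebb : dot d b b = h * h * dot d a a).
  { rewrite (dot_ext d b (lin h a 0 a) b (lin h a 0 a)); [|intros; unfold lin; rewrite E by assumption; ring..].
    rewrite dot_lin_l, dot_lin_r. ring. }
  assert (h <> 0) by (intros Z; apply Nb; rewrite Ebb, Z; ring).
  assert (0 <= h); [|lra].
  assert (0 <= dot d b a) by (specialize (Half 1 Rlt_0_1); lra).
  unfold h, Rdiv. apply Rmult_le_pos; [assumption|].
  left; apply Rinv_0_lt_compat; lra.
Qed.

Lemma uniform_delta (m : nat) (P : nat -> R -> Prop) :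
  (forall i a b, P i a -> b <= a -> P i b) ->
  (forall i, (i < m)%nat -> exists a, 0 < a /\ P i a) ->
  exists a, 0 < a /\ forall i, (i < m)%nat -> P i a.
Proof.
  intros Mon H. induction m as [|m IH].
  - exists 1; split; [lra|]. intros; lia.
  - destruct IH as [a [Ha Pa]]; [auto|].
    destruct (H m (Nat.lt_succ_diag_r m)) as [b [Hb Pb]].
    exists (Rmin a b); split; [now apply Rmin_pos|]. intros i Hi.
    destruct (Nat.eq_dec i m) as [->|Hne].
    + eapply Mon; [exact Pb|apply Rmin_r].
    + eapply Mon; [apply Pa; lia|apply Rmin_l].
Qed.

Lemma derivable_pos_right (p : R -> R) (l : R) :
  derivable_pt_lim p 0 l -> p 0 = 0 -> 0 < l ->
  exists a, 0 < a /\ forall s, 0 < s < a -> 0 < p s.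
Proof.
  intros H Z Hl. destruct (H l Hl) as [[a Ha] K]. exists a; split; [exact Ha|].
  intros s Hs. simpl in K. specialize (K s ltac:(lra)).
  rewrite Rabs_pos_eq in K by lra. specialize (K ltac:(lra)).
  rewrite Rplus_0_l, Z, Rminus_0_r in K. apply Rabs_def2 in K.
  assert (0 < p s / s) by lra.
  replace (p s) with (p s / s * s) by (field; lra). apply Rmult_lt_0_compat; lra.
Qed.

Lemma hess_uniform (d : nat) (U : Pt -> Prop) (f : Pt -> R) (p : Pt) (eps : R) :
  Cm d 2 U f -> U p -> 0 < eps ->
  exists delta, 0 < delta /\ forall y, inRd d y -> U y -> distRd d p y < delta ->
    forall i j, (i < d)%nat -> (j < d)%nat -> Rabs (hess f y i j - hess f p i j) < eps.
Proof.
  intros Hf Up He.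
  destruct (uniform_delta d (fun i a => forall y, inRd d y -> U y -> distRd d p y < a ->
    forall j, (j < d)%nat -> Rabs (hess f y i j - hess f p i j) < eps)) as [a [Ha K]].
  - intros i a b H Hb y Hy Uy Dy. apply H; auto; lra.
  - intros i Hi.
    destruct (uniform_delta d (fun j a => forall y, inRd d y -> U y -> distRd d p y < a ->
      Rabs (hess f y i j - hess f p i j) < eps)) as [a [Ha K]].
    + intros j a b H Hb y Hy Uy Dy. apply H; auto; lra.
    + intros j Hj.
      assert (Hc : continuous_on d U (pd i (pd j f)))
        by (apply (Cm_continuous d 0), Cm_pd, Cm_pd; assumption).
      exact (Hc p Up eps He).
    + exists a; split; [exact Ha|]. intros y Hy Uy Dy j Hj. now apply K.
  - exists a; split; [exact Ha|]. intros y Hy Uy Dy i j Hi Hj. now apply K.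
Qed.

Lemma lin_ball (d : nat) (p u : Pt) (t rad : R) :
  0 <= t <= 1 -> nrm d u < rad -> distRd d p (lin 1 p t u) < rad.
Proof.
  intros Ht Hu. rewrite distRd_lin, Rabs_pos_eq by lra.
  pose proof (nrm_nonneg d u). nra.
Qed.

(* Along the curve p + s v + s^2 w with v tangent, f behaves like
   s^2 (<grad f, w> + Hess f (v, v) / 2). *)
Lemma sign_along_parabola (d : nat) (U : Pt -> Prop) (f : Pt -> R) (p v w : Pt) (e : R) :
  openRd d U -> Cm d 2 U f -> U p -> f p = 0 -> inRd d v -> inRd d w ->
  dot d (grad f p) v = 0 ->
  0 < e * (dot d (grad f p) w + qf d (hess f p) v v / 2) ->
  exists a, 0 < a /\ forall s, 0 < s < a ->
    U (lin 1 p 1 (lin s v (s * s) w)) /\ 0 < e * f (lin 1 p 1 (lin s v (s * s) w)).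
Proof.
  intros HU Hf Up Zp Hv Hw Tv Pos.
  set (P := e * (dot d (grad f p) w + qf d (hess f p) v v / 2)) in *.
  pose proof (nrm_nonneg d v) as Nv. pose proof (nrm_nonneg d w) as Nw.
  pose proof (pos_INR d) as Pd. pose proof (Rabs_pos e) as Pe.
  set (N := nrm d v + nrm d w + 1).
  (* The displacement is s y with y = v + s w, so s^2 factors out of the Taylor formula. Two errors
     remain: the change of the Hessian from p to the intermediate point, controlled through [K], and
     the terms of Hess(y, y) involving w, controlled by s * [L]. Each is kept within P / 2 and
     enters with a factor 1/2, so more than P / 2 survives. The number [e] carries the sign and is
     used as 1 and -1. *)
  set (K := Rabs e * (INR d * INR d) * (N * N) + 1).
  assert (HN : 1 <= N) by (unfold N; lra).
  assert (HK : 0 < K).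
  { unfold K. assert (0 <= Rabs e * (INR d * INR d) * (N * N)); [|lra].
    repeat apply Rmult_le_pos; lra. }
  set (L := Rabs e * (Rabs (qf d (hess f p) v w + qf d (hess f p) w v) +
                      Rabs (qf d (hess f p) w w)) + 1).
  assert (HL : 0 < L).
  { unfold L. pose proof (Rabs_pos (qf d (hess f p) v w + qf d (hess f p) w v)).
    pose proof (Rabs_pos (qf d (hess f p) w w)).
    assert (0 <= Rabs e * (Rabs (qf d (hess f p) v w + qf d (hess f p) w v) +
                      Rabs (qf d (hess f p) w w))); [|lra]. apply Rmult_le_pos; lra. }
  destruct (proj2 HU p Up) as [a1 [Ha1 B1]].
  destruct (hess_uniform d U f p (P / (2 * K)) Hf Up) as [a2 [Ha2 B2]].
  { apply Rdiv_lt_0_compat; lra. }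
  set (a := Rmin 1 (Rmin (Rmin a1 a2 / N) (P / (2 * L)))).
  assert (Ha : 0 < a).
  { repeat apply Rmin_pos; try lra; apply Rdiv_lt_0_compat; try lra. now apply Rmin_pos. }
  exists a; split; [exact Ha|]. intros s Hs.
  assert (S1 : s < 1) by (eapply Rlt_le_trans; [apply Hs|apply Rmin_l]).
  assert (S2 : s * N < Rmin a1 a2).
  { assert (s < Rmin a1 a2 / N).
    { eapply Rlt_le_trans; [apply Hs|]. eapply Rle_trans; [apply Rmin_r|apply Rmin_l]. }
    apply Rmult_lt_compat_r with (r := N) in H; [|lra].
    replace (Rmin a1 a2 / N * N) with (Rmin a1 a2) in H by (field; lra). exact H. }
  assert (S3 : s * L < P / 2).
  { assert (s < P / (2 * L)).
    { eapply Rlt_le_trans; [apply Hs|]. eapply Rle_trans; [apply Rmin_r|apply Rmin_r]. }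
    apply Rmult_lt_compat_r with (r := L) in H; [|lra].
    replace (P / (2 * L) * L) with (P / 2) in H by (field; lra). exact H. }
  set (y := lin 1 v s w).
  assert (Ny : nrm d y <= N).
  { unfold y, N. eapply Rle_trans; [apply nrm_lin_le|].
    rewrite Rabs_R1, (Rabs_pos_eq s) by lra. nra. }
  set (u := lin s v (s * s) w).
  assert (Eu : u = lin s y 0 y)
    by (apply functional_extensionality; intro; unfold u, y, lin; ring).
  assert (Nu : nrm d u < Rmin a1 a2).
  { rewrite Eu. eapply Rle_lt_trans; [apply nrm_lin_le|].
    rewrite Rabs_R0, (Rabs_pos_eq s) by lra. nra. }
  assert (Hu : inRd d u) by (apply inRd_lin; assumption).
  assert (Seg : forall t, 0 <= t <= 1 -> inRd d (lin 1 p t u) /\ U (lin 1 p t u) /\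
                 distRd d p (lin 1 p t u) < a2).
  { intros t Ht. pose proof (lin_ball d p u t _ Ht Nu) as D.
    pose proof (Rmin_l a1 a2). pose proof (Rmin_r a1 a2).
    assert (I : inRd d (lin 1 p t u)) by (apply inRd_lin; [now apply HU|assumption]).
    split; [exact I|split; [apply B1; [exact I|lra]|lra]]. }
  split; [apply Seg; lra|].
  destruct (taylor_2 d U f p u HU Hf Hu) as [c [Hc ->]]; [intros; now apply Seg|].
  destruct (Seg c Hc) as (I & Uc & Dc).
  set (z := lin 1 p c u) in *.
  replace (dot d (grad f p) u) with (s * s * dot d (grad f p) w)
    by (unfold u; rewrite dot_lin_r, Tv; ring).
  replace (qf d (hess f z) u u) with (s * s * qf d (hess f z) y y)
    by (rewrite Eu, qf_lin_l, !qf_lin_r; ring).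
  rewrite Zp.
  replace (e * (0 + s * s * dot d (grad f p) w + s * s * qf d (hess f z) y y / 2))
    with (s * s * (e * (dot d (grad f p) w + qf d (hess f z) y y / 2))) by field.
  apply Rmult_lt_0_compat; [nra|].
  assert (E1 : Rabs (qf d (hess f z) y y - qf d (hess f p) y y) <=
               P / (2 * K) * (INR d * INR d) * (N * N)).
  { rewrite <- qf_minus. eapply Rle_trans.
    - apply qf_bound with (a := P / (2 * K)).
      + intros i j Hi Hj. left. now apply B2.
      + left; apply Rdiv_lt_0_compat; lra.
    - apply Rmult_le_compat_l.
      + apply Rmult_le_pos; [left; apply Rdiv_lt_0_compat; lra|nra].
      + pose proof (nrm_nonneg d y). nra. }
  assert (E2 : qf d (hess f p) y y = qf d (hess f p) v v +
     s * (qf d (hess f p) v w + qf d (hess f p) w v + s * qf d (hess f p) w w)).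
  { unfold y. rewrite qf_lin_l, !qf_lin_r. ring. }
  set (q1 := qf d (hess f z) y y) in *. set (q0 := qf d (hess f p) y y) in *.
  set (qv := qf d (hess f p) v v) in *.
  set (m1 := qf d (hess f p) v w + qf d (hess f p) w v) in *.
  set (m2 := qf d (hess f p) w w) in *.
  assert (F1 : Rabs (e * (q1 - q0)) <= P / 2).
  { rewrite Rabs_mult. apply Rle_trans with (Rabs e * (P / (2 * K) * (INR d * INR d) * (N * N))).
    - now apply Rmult_le_compat_l.
    - replace (P / 2) with (P / (2 * K) * K) by (field; lra).
      replace (Rabs e * (P / (2 * K) * (INR d * INR d) * (N * N)))
        with (P / (2 * K) * (Rabs e * (INR d * INR d) * (N * N))) by ring.
      apply Rmult_le_compat_l; [left; apply Rdiv_lt_0_compat; lra|]. unfold K; lra. }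
  assert (F2 : Rabs (e * (s * (m1 + s * m2))) < P / 2).
  { eapply Rle_lt_trans; [|exact S3].
    rewrite !Rabs_mult, (Rabs_pos_eq s) by lra.
    assert (Rabs (m1 + s * m2) <= Rabs m1 + Rabs m2).
    { eapply Rle_trans; [apply Rabs_triang|].
      rewrite Rabs_mult, (Rabs_pos_eq s) by lra. pose proof (Rabs_pos m2). nra. }
    unfold L. assert (Rabs e * Rabs (m1 + s * m2) <= Rabs e * (Rabs m1 + Rabs m2))
      by now apply Rmult_le_compat_l.
    nra. }
  assert (F1' : - (P / 2) <= e * (q1 - q0)).
  { pose proof (Rle_abs (- (e * (q1 - q0)))) as A1. rewrite Rabs_Ropp in A1. lra. }
  apply Rabs_def2 in F2.
  replace (e * (dot d (grad f p) w + q1 / 2))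
    with (P + e * (q1 - q0) / 2 + e * (s * (m1 + s * m2)) / 2).
  - lra.
  - unfold P. rewrite E2. field.
Qed.

(** * Two defining functions at a common boundary point *)

Section Comparison.

Variables (d : nat) (Om U V : Pt -> Prop) (r rho : Pt -> R) (p : Pt).
Hypothesis HO : openRd d Om.
Hypothesis Hr : is_defining d 2 Om U r.
Hypothesis Hrho : is_defining d 2 Om V rho.
Hypothesis Hp : boundary d Om p.

(** A direction along which r decreases to first order enters Om, so rho cannot increase along it to
    first order; this is the hypothesis of [parallel_of_half_space]. *)
Lemma gradients_parallel :
  exists h, 0 < h /\ forall i, (i < d)%nat -> grad rho p i = h * grad r p i.
Proof.
  pose proof (defining_boundary_0 _ _ _ _ _ _ HO Hr Hp) as Z.
  pose proof (defining_boundary_0 _ _ _ _ _ _ HO Hrho Hp) as Z'.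
  destruct Hr as (HU & BU & CU & SU & GU). destruct Hrho as (HV & BV & CV & SV & GV).
  apply parallel_of_half_space.
  - intros v Hv L. apply Rnot_lt_le. intros L'.
    set (P := fun t => lin 1 p t v).
    assert (P0 : P 0 = p)
      by (apply functional_extensionality; intro; unfold P, lin; ring).
    destruct (derivable_pos_right (fun t => - r (P t)) (- dot d (grad r p) v))
      as [a1 [Ha1 K1]]; [|rewrite P0; lra|lra|].
    { apply derivable_pt_lim_opp. apply (derive_line_0 d U); auto. now apply Cm_pred. }
    destruct (derivable_pos_right (fun t => rho (P t)) (dot d (grad rho p) v))
      as [a2 [Ha2 K2]]; [|now rewrite P0|lra|].
    { apply (derive_line_0 d V); auto. now apply Cm_pred. }
    destruct (proj2 HU p (BU p Hp)) as [a3 [Ha3 K3]].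
    destruct (proj2 HV p (BV p Hp)) as [a4 [Ha4 K4]].
    pose proof (nrm_nonneg d v) as Nv.
    set (b := Rmin a3 a4 / (nrm d v + 1)).
    assert (Hb : 0 < b) by (apply Rdiv_lt_0_compat; [now apply Rmin_pos|lra]).
    set (s := Rmin (Rmin a1 a2) b / 2).
    assert (Hs : 0 < Rmin (Rmin a1 a2) b) by (repeat apply Rmin_pos; assumption).
    pose proof (Rmin_l (Rmin a1 a2) b). pose proof (Rmin_r (Rmin a1 a2) b).
    pose proof (Rmin_l a1 a2). pose proof (Rmin_r a1 a2).
    pose proof (Rmin_l a3 a4). pose proof (Rmin_r a3 a4).
    specialize (K1 s ltac:(unfold s; lra)). specialize (K2 s ltac:(unfold s; lra)).
    assert (Ips : inRd d (P s)) by (apply inRd_lin; [now apply Hp|assumption]).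
    assert (Ds : distRd d p (P s) < Rmin a3 a4).
    { unfold P. rewrite distRd_lin, Rabs_pos_eq by (unfold s; lra).
      assert (s < b) by (unfold s; lra).
      apply Rle_lt_trans with (s * (nrm d v + 1)); [unfold s; nra|].
      apply Rmult_lt_compat_r with (r := nrm d v + 1) in H5; [|lra].
      replace (b * (nrm d v + 1)) with (Rmin a3 a4) in H5 by (unfold b; field; lra).
      exact H5. }
    assert (O : Om (P s)) by (apply SU; [apply K3; auto; lra|cbv beta in K1; lra]).
    apply SV in O; [lra|apply K4; auto; lra].
  - intros E. apply (GU p Hp). rewrite grad_norm_nrm. unfold nrm.
    change (fun i => pd i r p) with (grad r p). rewrite E. apply sqrt_0.
  - intros E. apply (GV p Hp). rewrite grad_norm_nrm. unfold nrm.
    change (fun i => pd i rho p) with (grad rho p). rewrite E. apply sqrt_0.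
Qed.

(* Otherwise, for a suitable normal w, the parabola p + s v + s^2 w
   would lie outside Om according to r and inside Om according to rho. *)
Lemma tangential_hess_compare (h : R) (v : Pt) :
  0 < h -> (forall i, (i < d)%nat -> grad rho p i = h * grad r p i) ->
  inRd d v -> dot d (grad r p) v = 0 ->
  h * qf d (hess r p) v v <= qf d (hess rho p) v v.
Proof.
  intros Hh Eg Hv Tv.
  pose proof (defining_boundary_0 _ _ _ _ _ _ HO Hr Hp) as Z.
  pose proof (defining_boundary_0 _ _ _ _ _ _ HO Hrho Hp) as Z'.
  destruct Hr as (HU & BU & CU & SU & GU). destruct Hrho as (HV & BV & CV & SV & GV).
  apply Rnot_lt_le. intros L.
  set (q := qf d (hess r p) v v) in *. set (q' := qf d (hess rho p) v v) in *.
  set (g := grad r p) in *.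
  assert (Ng : dot d g g <> 0).
  { intros E. apply (GU p Hp). rewrite grad_norm_nrm. unfold nrm.
    change (fun i => pd i r p) with g. rewrite E. apply sqrt_0. }
  (* The midpoint of -q/2 and -q'/(2h): then a + q/2 > 0 while h a + q'/2 < 0, so the second-order
     terms of r and rho have opposite signs on the parabola. *)
  set (a := - (q + q' / h) / 4).
  set (w := trunc d (lin (a / dot d g g) g 0 g)).
  assert (Egw : forall u, dot d (grad rho p) u = h * dot d g u).
  { intros u. rewrite (dot_ext d (grad rho p) (lin h g 0 g) u u);
      [rewrite dot_lin_l; ring| |reflexivity].
    intros i Hi. rewrite Eg by assumption. unfold lin; ring. }
  assert (Hgw : dot d g w = a).
  { unfold w. rewrite dot_trunc_r, dot_lin_r. field. exact Ng. }
  assert (Hq : q' / h < q).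
  { apply Rmult_lt_reg_r with h; [assumption|]. replace (q' / h * h) with q' by (field; lra). lra. }
  destruct (sign_along_parabola d U r p v w 1) as [a1 [Ha1 K1]]; auto.
  { apply inRd_trunc. }
  { fold g q. rewrite Hgw. unfold a. lra. }
  destruct (sign_along_parabola d V rho p v w (-1)) as [a2 [Ha2 K2]]; auto.
  { apply inRd_trunc. }
  { rewrite Egw, Tv. ring. }
  { fold q'. rewrite Egw, Hgw. replace q' with (h * (q' / h)) by (field; lra).
    unfold a. nra. }
  set (s := Rmin a1 a2 / 2).
  assert (0 < Rmin a1 a2) by now apply Rmin_pos.
  pose proof (Rmin_l a1 a2). pose proof (Rmin_r a1 a2).
  destruct (K1 s ltac:(unfold s; lra)) as [U1 P1].
  destruct (K2 s ltac:(unfold s; lra)) as [U2 P2].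
  assert (O : Om (lin 1 p 1 (lin s v (s * s) w))) by (apply SV; [assumption|lra]).
  apply SU in O; [lra|assumption].
Qed.

End Comparison.

(** * The Levi form as a real quadratic form *)

(* Multiplication by i in the coordinates z_j = x_j + i x_(n+j). *)
Definition Jmap (n : nat) (v : Pt) : Pt := fun k =>
  if Nat.ltb k n then - v (n + k)%nat else if Nat.ltb k (n + n) then v (k - n)%nat else 0.

Definition realvec (n : nat) (t : nat -> Cx) : Pt := fun k =>
  if Nat.ltb k n then cre (t k) else if Nat.ltb k (n + n) then cim (t (k - n)%nat) else 0.

Definition cxvec (n : nat) (v : Pt) : nat -> Cx := fun j => mkCx (v j) (v (n + j)%nat).

Lemma Jmap_lo (n k : nat) (v : Pt) : (k < n)%nat -> Jmap n v k = - v (n + k)%nat.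
Proof. intros H. unfold Jmap. destruct (Nat.ltb_spec k n); [reflexivity|lia]. Qed.

Lemma Jmap_hi (n k : nat) (v : Pt) : (k < n)%nat -> Jmap n v (n + k)%nat = v k.
Proof.
  intros H. unfold Jmap. destruct (Nat.ltb_spec (n + k) n); [lia|].
  destruct (Nat.ltb_spec (n + k) (n + n)); [|lia]. f_equal; lia.
Qed.

Lemma realvec_lo (n k : nat) (t : nat -> Cx) : (k < n)%nat -> realvec n t k = cre (t k).
Proof. intros H. unfold realvec. destruct (Nat.ltb_spec k n); [reflexivity|lia]. Qed.

Lemma realvec_hi (n k : nat) (t : nat -> Cx) : (k < n)%nat -> realvec n t (n + k)%nat = cim (t k).
Proof.
  intros H. unfold realvec. destruct (Nat.ltb_spec (n + k) n); [lia|].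
  destruct (Nat.ltb_spec (n + k) (n + n)); [|lia]. do 2 f_equal; lia.
Qed.

Lemma realvec_cxvec (n k : nat) (v : Pt) : (k < n + n)%nat -> realvec n (cxvec n v) k = v k.
Proof.
  intros H. unfold realvec, cxvec. destruct (Nat.ltb_spec k n); [reflexivity|].
  destruct (Nat.ltb_spec k (n + n)); [|lia]. simpl. f_equal; lia.
Qed.

Lemma Jmap_ext (n : nat) (u v : Pt) :
  (forall i, (i < n + n)%nat -> u i = v i) -> forall i, (i < n + n)%nat -> Jmap n u i = Jmap n v i.
Proof.
  intros H i Hi. unfold Jmap. destruct (Nat.ltb_spec i n); [rewrite H; [reflexivity|lia]|].
  destruct (Nat.ltb_spec i (n + n)); [apply H|]; lia.
Qed.

Lemma inRd_Jmap (n : nat) (v : Pt) : inRd (n + n) (Jmap n v).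
Proof.
  intros i Hi. unfold Jmap. destruct (Nat.ltb_spec i n); [lia|].
  destruct (Nat.ltb_spec i (n + n)); [lia|reflexivity].
Qed.

Lemma Jmap_lin (n : nat) (a b : R) (u v : Pt) :
  Jmap n (lin a u b v) = lin a (Jmap n u) b (Jmap n v).
Proof.
  apply functional_extensionality; intro k. unfold Jmap, lin.
  destruct (Nat.ltb k n); [ring|]. destruct (Nat.ltb k (n + n)); ring.
Qed.

Lemma Jmap_Jmap (n k : nat) (v : Pt) : (k < n + n)%nat -> Jmap n (Jmap n v) k = - v k.
Proof.
  intros Hk. destruct (Nat.lt_ge_cases k n).
  - rewrite Jmap_lo, Jmap_hi by assumption. reflexivity.
  - replace k with (n + (k - n))%nat by lia. rewrite Jmap_hi, Jmap_lo by lia. reflexivity.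
Qed.

Lemma dot_split (n : nat) (u v : Pt) :
  dot (n + n) u v = rsum n (fun i => u i * v i + u (n + i)%nat * v (n + i)%nat).
Proof. unfold dot. now rewrite rsum_add, <- rsum_plus. Qed.

Lemma dot_Jmap_r (n : nat) (u v : Pt) : dot (n + n) u (Jmap n v) = - dot (n + n) (Jmap n u) v.
Proof.
  rewrite !dot_split. replace (- rsum n _) with (-1 * rsum n
    (fun i => Jmap n u i * v i + Jmap n u (n + i)%nat * v (n + i)%nat)) by ring.
  rewrite <- rsum_scal. apply rsum_ext; intros i Hi.
  rewrite !(Jmap_lo n i), !(Jmap_hi n i) by assumption. ring.
Qed.

Lemma dot_Jmap_Jmap (n : nat) (u v : Pt) : dot (n + n) (Jmap n u) (Jmap n v) = dot (n + n) u v.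
Proof.
  rewrite !dot_split. apply rsum_ext; intros i Hi.
  rewrite !(Jmap_lo n i), !(Jmap_hi n i) by assumption. ring.
Qed.

Lemma nrm_Jmap (n : nat) (u : Pt) : nrm (n + n) (Jmap n u) = nrm (n + n) u.
Proof. unfold nrm. now rewrite dot_Jmap_Jmap. Qed.

(** Twice the J-invariant part of the quadratic form A; for a real Hessian it is four times the Levi
    form. *)
Definition qfJ (n : nat) (A : nat -> nat -> R) (v : Pt) : R :=
  qf (n + n) A v v + qf (n + n) A (Jmap n v) (Jmap n v).

Lemma qf_split (n : nat) (A : nat -> nat -> R) (u v : Pt) :
  qf (n + n) A u v = rsum n (fun i => rsum n (fun j =>
    A i j * u i * v j + A i (n + j)%nat * u i * v (n + j)%nat +
    A (n + i)%nat j * u (n + i)%nat * v j +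
    A (n + i)%nat (n + j)%nat * u (n + i)%nat * v (n + j)%nat)).
Proof.
  unfold qf. rewrite rsum_add, <- rsum_plus. apply rsum_ext; intros i Hi.
  rewrite !rsum_add, <- !rsum_plus. apply rsum_ext; intros j Hj. ring.
Qed.

Lemma cre_Csum (k : nat) (f : nat -> Cx) : cre (Csum k f) = rsum k (fun i => cre (f i)).
Proof. induction k as [|k IH]; simpl; [reflexivity|now rewrite IH]. Qed.

Lemma cim_Csum (k : nat) (f : nat -> Cx) : cim (Csum k f) = rsum k (fun i => cim (f i)).
Proof. induction k as [|k IH]; simpl; [reflexivity|now rewrite IH]. Qed.

(** The identity already holds for each pair of indices (j, k) separately, which is why the sums are
    peeled off in parallel. *)
Lemma levi_real (n : nat) (f : Pt -> R) (x : Pt) (t : nat -> Cx) :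
  cre (levi n f x t) = / 4 * qfJ n (hess f x) (realvec n t).
Proof.
  unfold levi, qfJ. rewrite cre_Csum, !qf_split, <- rsum_plus, <- rsum_scal.
  apply rsum_ext; intros j Hj.
  rewrite cre_Csum, <- rsum_plus, <- rsum_scal. apply rsum_ext; intros k Hk.
  rewrite !(Jmap_lo n j), !(Jmap_hi n j), !(Jmap_lo n k), !(Jmap_hi n k),
    !(realvec_lo n j), !(realvec_hi n j), !(realvec_lo n k), !(realvec_hi n k) by assumption.
  unfold hess, ddbar; simpl. field.
Qed.

(** With v the real vector of t, the real and imaginary parts of the complex equation are <grad f,
    v> / 2 and - <grad f, J v> / 2. *)
Lemma cx_tangent_real (n : nat) (f : Pt -> R) (p : Pt) (t : nat -> Cx) :
  dot (n + n) (grad f p) (realvec n t) = 0 ->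
  dot (n + n) (grad f p) (Jmap n (realvec n t)) = 0 -> cx_tangent n f p t.
Proof.
  intros H1 H2. unfold cx_tangent.
  set (S := Csum n _).
  assert (E1 : cre S = / 2 * dot (n + n) (grad f p) (realvec n t)).
  { unfold S. rewrite cre_Csum, dot_split, <- rsum_scal. apply rsum_ext; intros j Hj.
    rewrite (realvec_lo n j), (realvec_hi n j) by assumption. unfold grad; simpl. field. }
  assert (E2 : cim S = - / 2 * dot (n + n) (grad f p) (Jmap n (realvec n t))).
  { unfold S. rewrite cim_Csum, dot_split, <- rsum_scal. apply rsum_ext; intros j Hj.
    rewrite (Jmap_lo n j), (Jmap_hi n j), (realvec_lo n j), (realvec_hi n j) by assumption. unfold grad; simpl. field. }
  destruct S as [a b]; simpl in E1, E2. unfold C0. f_equal; nra.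
Qed.

Lemma cnorm2_real (n : nat) (t : nat -> Cx) :
  cnorm2 n t = dot (n + n) (realvec n t) (realvec n t).
Proof.
  unfold cnorm2. rewrite dot_split. apply rsum_ext; intros j Hj.
  rewrite (realvec_lo n j), (realvec_hi n j) by assumption. unfold Cabs2. ring.
Qed.

Lemma realvec_pos (n j : nat) (t : nat -> Cx) :
  (j < n)%nat -> t j <> C0 -> 0 < dot (n + n) (realvec n t) (realvec n t).
Proof.
  intros Hj Ht. pose proof (dot_self_nonneg (n + n) (realvec n t)) as P.
  destruct (Rle_lt_or_eq_dec _ _ P) as [L|E]; [exact L|exfalso]. apply Ht.
  symmetry in E.
  pose proof (dot_self_eq_0 (n + n) j _ E ltac:(lia)) as E1.
  pose proof (dot_self_eq_0 (n + n) (n + j) _ E ltac:(lia)) as E2.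
  rewrite realvec_lo in E1 by assumption. rewrite realvec_hi in E2 by assumption.
  destruct (t j); simpl in *. unfold C0; congruence.
Qed.

(** * From tangential positivity to coercivity in all directions *)

(** For g = grad r and w the real vector of t this is 4 |sum_j (dr/dz_j) t_j|^2, normalized to match
    [qfJ]. *)
Definition dotJ2 (n : nat) (g w : Pt) : R :=
  dot (n + n) g w * dot (n + n) g w + dot (n + n) g (Jmap n w) * dot (n + n) g (Jmap n w).

(* Split w into its complex tangential part and its component nu along g and J g;
   the term dotJ2 controls |nu|^2 and absorbs the mixed terms. *)
Lemma coercive_of_tangential (n : nat) (A : nat -> nat -> R) (g w : Pt) (K k c L : R) :
  (forall i j, (i < n + n)%nat -> (j < n + n)%nat -> Rabs (A i j) <= K) -> 0 <= K ->
  0 < k -> 0 < c -> c * c <= dot (n + n) g g ->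
  (forall v, dot (n + n) g v = 0 -> dot (n + n) g (Jmap n v) = 0 ->
     k * dot (n + n) v v <= qfJ n A v) ->
  let Q := K * (INR (n + n) * INR (n + n)) in
  2 * Q + 8 * Q * Q / k + k / 2 <= L * (c * c) ->
  k / 4 * dot (n + n) w w <= qfJ n A w + L * dotJ2 n g w.
Proof.
  intros HA HK Hk Hc Hg HT Q HL.
  set (d := (n + n)%nat) in *.
  assert (HQ : 0 <= Q) by (unfold Q; pose proof (pos_INR d); apply Rmult_le_pos; nra).
  set (G := dot d g g) in *. assert (HG : 0 < G) by nra.
  set (al := dot d g w). set (be := dot d g (Jmap n w)).
  (* Since g and J g are orthogonal of the same length, [nu] is the vector in their span with <g,
     nu> = <g, w> and <g, J nu> = <g, J w>; hence w - nu is complex tangential. *)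
  set (nu := lin (al / G) g (- (be / G)) (Jmap n g)).
  set (ta := lin 1 w (-1) nu).
  assert (gJg : dot d g (Jmap n g) = 0).
  { pose proof (dot_Jmap_r n g g) as H. rewrite (dot_comm (n + n) (Jmap n g)) in H. fold d in H. lra. }
  assert (Jgw : dot d (Jmap n g) w = - be).
  { unfold be. pose proof (dot_Jmap_r n g w) as H. fold d in H. lra. }
  assert (Jnu : forall i, (i < d)%nat -> Jmap n nu i = lin (al / G) (Jmap n g) (be / G) g i).
  { intros i Hi. unfold nu. rewrite Jmap_lin. unfold lin. rewrite Jmap_Jmap by exact Hi. ring. }
  assert (T1 : dot d g nu = al).
  { unfold nu. rewrite dot_lin_r, gJg. fold G. field. lra. }
  assert (T2 : dot d g (Jmap n nu) = be).
  { rewrite (dot_ext d g g _ _ (fun _ _ => eq_refl) Jnu), dot_lin_r, gJg. fold G. field. lra. }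
  assert (Nnu : G * dot d nu nu = al * al + be * be).
  { unfold nu. rewrite dot_lin_l, !dot_lin_r, (dot_comm d (Jmap n g) g), gJg.
    unfold d at 2. rewrite dot_Jmap_Jmap. fold d G. field. lra. }
  assert (Hta : k * dot d ta ta <= qfJ n A ta).
  { apply HT; unfold ta; rewrite ?Jmap_lin, dot_lin_r.
    - rewrite T1. unfold al. ring.
    - rewrite T2. unfold be. ring. }
  assert (Ew : w = lin 1 ta 1 nu)
    by (apply functional_extensionality; intro; unfold ta, lin; ring).
  clearbody ta nu.
  set (T := nrm d ta). set (S := nrm d nu).
  assert (PT : 0 <= T) by apply nrm_nonneg. assert (PS : 0 <= S) by apply nrm_nonneg.
  assert (ET : dot d ta ta = T * T) by (symmetry; apply nrm_sqr).
  assert (ES : dot d nu nu = S * S) by (symmetry; apply nrm_sqr).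
  assert (Bd : forall u v, Rabs (qf d A u v) <= Q * (nrm d u * nrm d v)).
  { intros u v. unfold Q. apply qf_bound; assumption. }
  assert (Mix : qfJ n A ta - 4 * Q * (T * S) - 2 * Q * (S * S) <= qfJ n A w).
  { rewrite Ew. unfold qfJ. rewrite Jmap_lin. fold d.
    rewrite !qf_lin_l, !qf_lin_r.
    pose proof (Bd ta nu) as B1. pose proof (Bd nu ta) as B2. pose proof (Bd nu nu) as B3.
    pose proof (Bd (Jmap n ta) (Jmap n nu)) as B4. pose proof (Bd (Jmap n nu) (Jmap n ta)) as B5.
    pose proof (Bd (Jmap n nu) (Jmap n nu)) as B6.
    assert (NJ : forall u, nrm d (Jmap n u) = nrm d u) by (intro; apply nrm_Jmap).
    rewrite (NJ ta), (NJ nu) in B4, B5. rewrite (NJ nu) in B6. fold T S in B1, B2, B3, B4, B5, B6.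
    apply Rabs_le_between in B1, B2, B3, B4, B5, B6. lra. }
  assert (W2 : dot d w w <= 2 * (T * T) + 2 * (S * S)).
  { rewrite <- nrm_sqr. rewrite Ew.
    pose proof (nrm_lin_le d 1 1 ta nu) as H. rewrite Rabs_R1 in H. fold T S in H.
    pose proof (nrm_nonneg d (lin 1 ta 1 nu)) as P.
    assert (nrm d (lin 1 ta 1 nu) * nrm d (lin 1 ta 1 nu) <= (T + S) * (T + S))
      by (apply Rmult_le_compat; lra).
    pose proof (Rle_0_sqr (T - S)) as Sq. unfold Rsqr in Sq. lra. }
  (* The completed square gives up half of k T^2. This accounts for the terms of [HL]: 2 Q pays for
     nu against itself, 8 Q^2 / k for the mixed terms, and k / 2 for the S^2 in the bound on
     |w|^2. *)
  assert (AM : 4 * Q * (T * S) <= k / 2 * (T * T) + 8 * Q * Q / k * (S * S)).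
  { assert (H : 0 <= (k * T - 4 * Q * S) * (k * T - 4 * Q * S) * / (2 * k)).
    { apply Rmult_le_pos; [apply Rle_0_sqr|]. left; apply Rinv_0_lt_compat; lra. }
    replace ((k * T - 4 * Q * S) * (k * T - 4 * Q * S) * / (2 * k))
      with (k / 2 * (T * T) + 8 * Q * Q / k * (S * S) - 4 * Q * (T * S)) in H by (field; lra).
    lra. }
  assert (PL : 0 < L).
  { assert (0 <= 8 * Q * Q / k).
    { unfold Rdiv. apply Rmult_le_pos; [nra|]. left; now apply Rinv_0_lt_compat. }
    assert (0 < L * (c * c)) by lra. nra. }
  assert (N2 : (2 * Q + 8 * Q * Q / k + k / 2) * (S * S) <= L * dotJ2 n g w).
  { unfold dotJ2. fold d al be. rewrite <- Nnu, ES.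
    apply Rle_trans with (L * (c * c) * (S * S)).
    - apply Rmult_le_compat_r; nra.
    - rewrite Rmult_assoc. apply Rmult_le_compat_l; [lra|]. apply Rmult_le_compat_r; nra. }
  rewrite ET in Hta. nra.
Qed.

(** In the loss, 2 counts the Hessian terms at w and J w. The part 4 L G comes from factoring <g',
    u>^2 - <g, u>^2 as difference times sum, a factor 2 G from the sum, again for u = w and u = J
    w. *)
Lemma coercive_perturb (n : nat) (A A' : nat -> nat -> R) (g g' w : Pt) (a G k L : R) :
  (forall i j, (i < n + n)%nat -> (j < n + n)%nat -> Rabs (A' i j - A i j) <= a) ->
  (forall i, (i < n + n)%nat -> Rabs (g' i - g i) <= a) ->
  (forall i, (i < n + n)%nat -> Rabs (g i) <= G) ->
  (forall i, (i < n + n)%nat -> Rabs (g' i) <= G) ->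
  0 <= a -> 0 <= G -> 0 <= L ->
  k * dot (n + n) w w <= qfJ n A w + L * dotJ2 n g w ->
  (k - a * (2 + 4 * L * G) * (INR (n + n) * INR (n + n))) * dot (n + n) w w
    <= qfJ n A' w + L * dotJ2 n g' w.
Proof.
  intros HA Hg HG HG' Ha PG PL H. set (d := (n + n)%nat) in *.
  set (D := INR d). assert (PD : 0 <= D) by apply pos_INR.
  assert (Lin : forall (b : Pt) (e : R) (u : Pt), 0 <= e ->
    (forall i, (i < d)%nat -> Rabs (b i) <= e) -> Rabs (dot d b u) <= e * (D * nrm d u)).
  { intros b e u He Hb. unfold dot. eapply Rle_trans; [apply rsum_Rabs|].
    apply Rle_trans with (rsum d (fun i => e * Rabs (u i))).
    - apply rsum_le; intros i Hi. rewrite Rabs_mult.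
      apply Rmult_le_compat_r; [apply Rabs_pos|auto].
    - rewrite rsum_scal. apply Rmult_le_compat_l; [exact He|apply rsum_Rabs_le_nrm]. }
  assert (Sq : forall u, nrm d u = nrm d w ->
    - (2 * a * G * (D * D) * dot d w w) <=
      dot d g' u * dot d g' u - dot d g u * dot d g u).
  { intros u Hu.
    pose proof (Lin _ G u PG HG) as B1. pose proof (Lin _ G u PG HG') as B2.
    assert (B3 : Rabs (dot d g' u - dot d g u) <= a * (D * nrm d u)).
    { replace (dot d g' u - dot d g u) with (dot d (lin 1 g' (-1) g) u)
        by (rewrite dot_lin_l; ring).
      apply Lin; [exact Ha|]. intros i Hi. unfold lin.
      replace (1 * g' i + -1 * g i) with (g' i - g i) by ring. auto. }
    rewrite Hu in *.
    assert (B4 : Rabs (dot d g' u + dot d g u) <= 2 * (G * (D * nrm d w))).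
    { eapply Rle_trans; [apply Rabs_triang|]. lra. }
    assert (B5 : Rabs ((dot d g' u - dot d g u) * (dot d g' u + dot d g u)) <=
                 a * (D * nrm d w) * (2 * (G * (D * nrm d w)))).
    { rewrite Rabs_mult. apply Rmult_le_compat; auto using Rabs_pos. }
    apply Rabs_le_between in B5. rewrite <- nrm_sqr. lra. }
  assert (Qd : forall u, nrm d u = nrm d w ->
    - (a * (D * D) * dot d w w) <= qf d A' u u - qf d A u u).
  { intros u Hu. rewrite <- qf_minus.
    pose proof (qf_bound d (fun i j => A' i j - A i j) a u u HA Ha) as B.
    rewrite Hu, nrm_sqr in B. apply Rabs_le_between in B. unfold D. lra. }
  pose proof (Sq w eq_refl) as S1. pose proof (Sq (Jmap n w) (nrm_Jmap n w)) as S2.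
  pose proof (Qd w eq_refl) as Q1. pose proof (Qd (Jmap n w) (nrm_Jmap n w)) as Q2.
  unfold qfJ, dotJ2 in *. fold d in H |- *.
  apply Rmult_le_compat_l with (r := L) in S1, S2; try assumption. lra.
Qed.

(** * The convex increasing function composed with the defining function *)

Definition pospart (s : R) : R := Rmax 0 s.

Lemma pospart_nonneg (s : R) : 0 <= pospart s.
Proof. apply Rmax_l. Qed.

(** A two-sided error bound treats the kink of [pospart] like any other point, by plain case
    analysis. *)
Lemma derivable_of_quadratic_error (f : R -> R) (x l K : R) :
  (forall h, Rabs h < 1 -> Rabs (f (x + h) - f x - l * h) <= K * (h * h)) ->
  derivable_pt_lim f x l.
Proof.
  intros H eps He. pose proof (Rabs_pos K) as PK.
  assert (Hd : 0 < Rmin 1 (eps / (Rabs K + 1)))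
    by (apply Rmin_pos; [lra|apply Rdiv_lt_0_compat; lra]).
  exists (mkposreal _ Hd). simpl. intros h Hh Hlt.
  assert (h1 : Rabs h < 1) by (eapply Rlt_le_trans; [exact Hlt|apply Rmin_l]).
  assert (h2 : Rabs h < eps / (Rabs K + 1)) by (eapply Rlt_le_trans; [exact Hlt|apply Rmin_r]).
  apply Rmult_lt_compat_r with (r := Rabs K + 1) in h2; [|lra].
  replace (eps / (Rabs K + 1) * (Rabs K + 1)) with eps in h2 by (field; lra).
  assert (Ph : 0 < Rabs h) by now apply Rabs_pos_lt.
  replace ((f (x + h) - f x) / h - l) with ((f (x + h) - f x - l * h) / h) by (field; assumption).
  unfold Rdiv. rewrite Rabs_mult, Rabs_inv.
  apply Rmult_lt_reg_r with (Rabs h); [exact Ph|].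
  rewrite Rmult_assoc, Rinv_l, Rmult_1_r by lra.
  eapply Rle_lt_trans; [now apply H|].
  replace (h * h) with (Rabs h * Rabs h) by (rewrite <- Rabs_mult, Rabs_pos_eq; nra).
  pose proof (Rle_abs K). nra.
Qed.

Lemma derivable_pospart_sqr (s : R) :
  derivable_pt_lim (fun s => 3 * pospart s ^ 2) s (6 * pospart s).
Proof.
  apply derivable_of_quadratic_error with (K := 9). intros h Hh.
  apply Rabs_le. unfold pospart, Rmax.
  destruct (Rle_dec 0 (s + h)); destruct (Rle_dec 0 s); nra.
Qed.

Lemma derivable_pospart_cube (b s : R) :
  derivable_pt_lim (fun s => pospart s ^ 3 - b) s (3 * pospart s ^ 2).
Proof.
  (* On the positive side the error is (3 s + h) h^2; across the kink it is at most 3 h^2, because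
     the distance to 0 is then at most |h| < 1. *)
  apply derivable_of_quadratic_error with (K := 3 * Rabs s + 4). intros h Hh.
  assert (Hh' : -1 < h < 1) by (apply Rabs_def2 in Hh; lra).
  apply Rabs_le. unfold pospart, Rmax, Rabs.
  destruct (Rcase_abs s); destruct (Rle_dec 0 (s + h)); destruct (Rle_dec 0 s); try lra.
  - assert (0 <= s + h <= h) by lra. assert ((s + h) ^ 3 <= h * h * 1); [|nra].
    replace ((s+h)^3) with ((s+h)*(s+h)*(s+h)) by ring.
    apply Rmult_le_compat; nra.
  - nra.
  - replace ((s + h) ^ 3 - b - (s ^ 3 - b) - 3 * s ^ 2 * h) with ((3 * s + h) * (h * h)) by ring.
    nra.
  - assert (0 <= s < - h) by lra. assert (0 <= s * s <= h * h) by nra.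
    replace (0 ^ 3 - b - (s ^ 3 - b) - 3 * s ^ 2 * h) with (s * s * (- s - 3 * h)) by ring.
    assert (0 <= - s - 3 * h <= 3) by lra. nra.
Qed.

Lemma derivable_shift (f : R -> R) (b s l : R) :
  derivable_pt_lim f (s + b) l -> derivable_pt_lim (fun x => f (x + b)) s l.
Proof.
  intros H eps He. destruct (H eps He) as [del K]. exists del. intros h Hh Hlt.
  replace (s + h + b) with (s + b + h) by ring. now apply K.
Qed.

Lemma continuity_pospart : continuity pospart.
Proof.
  replace pospart with (fun s => (s + Rabs s) * / 2).
  - intros s. apply continuity_pt_mult; [|apply continuity_pt_const; now intros ? ?].
    apply continuity_pt_plus; [apply continuity_pt_id|apply Rcontinuity_abs].
  - apply functional_extensionality; intro s. unfold pospart, Rmax, Rabs.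
    destruct (Rle_dec 0 s); destruct (Rcase_abs s); lra.
Qed.

(** The cube is the least integer power of [pospart] that is C^2; subtracting eta^3 puts the zero
    back at s = 0, so the boundary is kept. *)
Definition bump (eta s : R) : R := pospart (s + eta) ^ 3 - eta ^ 3.
Definition bump1 (eta s : R) : R := 3 * pospart (s + eta) ^ 2.
Definition bump2 (eta s : R) : R := 6 * pospart (s + eta).

Lemma derivable_bump (eta s : R) : derivable_pt_lim (bump eta) s (bump1 eta s).
Proof. apply (derivable_shift (fun s => pospart s ^ 3 - eta ^ 3)), derivable_pospart_cube. Qed.

Lemma derivable_bump1 (eta s : R) : derivable_pt_lim (bump1 eta) s (bump2 eta s).
Proof. apply (derivable_shift (fun s => 3 * pospart s ^ 2)), derivable_pospart_sqr. Qed.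

Lemma continuity_bump2 (eta : R) : continuity (bump2 eta).
Proof.
  intros s. unfold bump2. apply continuity_pt_mult.
  - apply continuity_pt_const; now intros ? ?.
  - apply (continuity_pt_comp (fun s => s + eta) pospart); [|apply continuity_pospart].
    apply continuity_pt_plus; [apply continuity_pt_id|].
    apply continuity_pt_const; now intros ? ?.
Qed.

Lemma bump_neg (eta s : R) : 0 < eta -> (bump eta s < 0 <-> s < 0).
Proof.
  intros He. unfold bump, pospart, Rmax. destruct (Rle_dec 0 (s + eta)) as [L|L].
  - replace ((s + eta) ^ 3 - eta ^ 3) with (s * ((s + eta) ^ 2 + (s + eta) * eta + eta ^ 2)) by ring.
    assert (0 < (s + eta) ^ 2 + (s + eta) * eta + eta ^ 2) by nra.
    split; intros; nra.
  - assert (0 < eta ^ 3) by now apply pow_lt. split; intros; [lra|].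
    replace (0 ^ 3) with 0 by ring. lra.
Qed.

Lemma bump_below (eta s : R) : s <= - eta -> bump eta s = - eta ^ 3.
Proof.
  intros H. unfold bump, pospart. rewrite Rmax_left by lra. ring.
Qed.

Lemma qfJ_ext (n : nat) (A A' : nat -> nat -> R) (v : Pt) :
  (forall i j, (i < n + n)%nat -> (j < n + n)%nat -> A i j = A' i j) ->
  qfJ n A v = qfJ n A' v.
Proof. intros H. unfold qfJ. f_equal; apply qf_ext; auto. Qed.

Lemma qfJ_0 (n : nat) (A : nat -> nat -> R) (v : Pt) :
  (forall i j, (i < n + n)%nat -> (j < n + n)%nat -> A i j = 0) -> qfJ n A v = 0.
Proof.
  intros H.
  assert (E : forall u, qf (n + n) A u u = 0).
  { intros u. pose proof (qf_bound (n + n) A 0 u u) as B.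
    assert (Rabs (qf (n + n) A u u) <= 0).
    { eapply Rle_trans; [apply B; [|lra]|lra].
      intros i j Hi Hj. rewrite H, Rabs_R0 by assumption. lra. }
    apply Rabs_le_between in H0. lra. }
  unfold qfJ. rewrite !E. ring.
Qed.

Lemma dotJ2_nonneg (n : nat) (g w : Pt) : 0 <= dotJ2 n g w.
Proof. unfold dotJ2. nra. Qed.

Lemma qfJ_bump (n : nat) (U : Pt -> Prop) (r : Pt -> R) (eta : R) (x v : Pt) :
  openRd (n + n) U -> Cm (n + n) 2 U r -> U x ->
  qfJ n (hess (fun y => bump eta (r y)) x) v =
  bump1 eta (r x) * qfJ n (hess r x) v + bump2 eta (r x) * dotJ2 n (grad r x) v.
Proof.
  intros HU Cr Ux.
  rewrite (qfJ_ext n _ (fun i j => bump1 eta (r x) * hess r x i j +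
             bump2 eta (r x) * (grad r x i * grad r x j))).
  - unfold qfJ, dotJ2. rewrite !qf_rank_one. ring.
  - intros i j Hi Hj.
    exact (pd_pd_comp _ U r (bump eta) (bump1 eta) (bump2 eta) HU (derivable_bump eta)
             (derivable_bump1 eta) Cr i j x Hi Hj Ux).
Qed.

(* bump2 / bump1 = 2 / (s + eta) exceeds the given constant L. *)
Lemma qfJ_bump_lower (n : nat) (U : Pt -> Prop) (r : Pt -> R) (eta k L : R) (x v : Pt) :
  openRd (n + n) U -> Cm (n + n) 2 U r -> U x ->
  pospart (r x + eta) * L <= 2 ->
  k * dot (n + n) v v <= qfJ n (hess r x) v + L * dotJ2 n (grad r x) v ->
  3 * pospart (r x + eta) ^ 2 * (k * dot (n + n) v v) <=
  qfJ n (hess (fun y => bump eta (r y)) x) v.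
Proof.
  intros HU Cr Ux Hm H. rewrite (qfJ_bump n U) by assumption. unfold bump1, bump2.
  pose proof (pospart_nonneg (r x + eta)) as Pm. set (m := pospart (r x + eta)) in *.
  pose proof (dotJ2_nonneg n (grad r x) v) as PZ. set (Z := dotJ2 n (grad r x) v) in *.
  set (B := qfJ n (hess r x) v) in *.
  apply Rle_trans with (3 * m ^ 2 * (B + L * Z)).
  - apply Rmult_le_compat_l; [nra|exact H].
  (* This is (F'' - L F') Z >= 0 with F' = 3 m^2 and F'' = 6 m. Written without division, it also
     covers m = 0, where F is flat. *)
  - assert (0 <= 3 * (m * Z) * (2 - m * L)).
    { apply Rmult_le_pos; [|lra]. assert (0 <= m * Z) by now apply Rmult_le_pos. lra. }
    nra.
Qed.

Lemma grad_norm_bump (d : nat) (U : Pt -> Prop) (r : Pt -> R) (eta : R) (x : Pt) :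
  0 < eta -> openRd d U -> Cm d 2 U r -> U x -> r x = 0 -> grad_norm d r x <> 0 ->
  grad_norm d (fun y => bump eta (r y)) x <> 0.
Proof.
  intros He HU Cr Ux Z N. rewrite grad_norm_nrm.
  rewrite (nrm_ext d _ (fun i => bump1 eta 0 * pd i r x)).
  - rewrite nrm_scal, <- grad_norm_nrm. apply Rmult_integral_contrapositive.
    split; [|exact N]. apply Rabs_no_R0. unfold bump1, pospart.
    rewrite Rmax_right by lra. nra.
  - intros i Hi. rewrite <- Z.
    exact (pd_comp d U r (bump eta) (bump1 eta) (derivable_bump eta) Cr i x Hi Ux).
Qed.

Lemma is_defining_bump (d : nat) (Om U W : Pt -> Prop) (r : Pt -> R) (eta : R) :
  0 < eta -> openRd d Om -> is_defining d 2 Om U r -> openRd d W ->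
  (forall x, W x -> U x) -> (forall p, boundary d Om p -> W p) ->
  is_defining d 2 Om W (fun y => bump eta (r y)).
Proof.
  intros He HO Hr HW WU BW.
  pose proof (fun p => defining_boundary_0 _ _ _ _ _ p HO Hr) as Z.
  destruct Hr as (HU & BU & CU & SU & GU).
  split; [exact HW|]. split; [exact BW|]. split; [|split].
  - apply (Cm_subset d 2 U); [exact WU|].
    exact (Cm_comp d U r (bump eta) (bump1 eta) (bump2 eta) HU (derivable_bump eta)
             (derivable_bump1 eta) (continuity_bump2 eta) CU).
  - intros x Wx. rewrite bump_neg by exact He. auto.
  - intros p Hp. apply (grad_norm_bump d U); auto.
Qed.

(** * Locality and uniform neighborhoods of the boundary *)

Lemma hess_local (d i j : nat) (W : Pt -> Prop) (f g : Pt -> R) (x : Pt) :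
  openRd d W -> W x -> (i < d)%nat -> (j < d)%nat -> (forall y, W y -> f y = g y) ->
  hess f x i j = hess g x i j.
Proof.
  intros HW Wx Hi Hj E. unfold hess. apply (pd_local d i W); auto.
  intros y Wy. apply (pd_local d j W); auto.
Qed.

Lemma openRd_ball (d : nat) (x : Pt) (a : R) :
  openRd d (fun y => inRd d y /\ distRd d x y < a).
Proof.
  split; [tauto|]. intros y [Hy Dy]. exists (a - distRd d x y). split; [lra|].
  intros z Hz Dz. split; [exact Hz|].
  pose proof (distRd_triangle d x y z). lra.
Qed.

Lemma openRd_near_boundary (d : nat) (Om : Pt -> Prop) (a : R) :
  openRd d (fun x => inRd d x /\ exists p, boundary d Om p /\ distRd d x p < a).
Proof.
  split; [tauto|]. intros x [Hx [p [Hp Dp]]]. exists (a - distRd d x p). split; [lra|].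
  intros y Hy Dy. split; [exact Hy|]. exists p; split; [exact Hp|].
  pose proof (distRd_triangle d y x p). rewrite (distRd_sym d y x) in H. lra.
Qed.

(** If a point z outside U were closer than delta to p, the segment from p to z would meet the
    boundary of U within delta of p. *)
Lemma unif_defining_ball (d m : nat) (Om U : Pt -> Prop) (r : Pt -> R) :
  unif_defining d m Om U r ->
  exists delta, 0 < delta /\ forall p z, boundary d Om p -> inRd d z ->
    distRd d p z < delta -> U z.
Proof.
  intros [(HU & BU & _) [[del [Hd K]] _]]. exists del; split; [exact Hd|].
  intros p z Hp Hz Dz. apply NNPP. intros Nz.
  destruct (segment_boundary d U p z) as [q [Hq Dq]]; auto.
  - now apply Hp.
  - pose proof (K p q Hp Hq). lra.
Qed.

(** * Transferring the Levi condition between defining functions *)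

(** The gradient norm scales by h and the tangential Hessian by at least h, so the normalized
    inequality keeps its constant C; the 4 comes from [levi_real]. *)
Lemma tangential_levi_transfer (n : nat) (Om U1 U : Pt -> Prop) (r1 r : Pt -> R) (C : R) (p v : Pt) :
  openRd (n + n) Om -> is_defining (n + n) 2 Om U1 r1 -> is_defining (n + n) 2 Om U r ->
  boundary (n + n) Om p ->
  (forall t, cx_tangent n r1 p t ->
     C * grad_norm (n + n) r1 p * cnorm2 n t <= cre (levi n r1 p t)) ->
  dot (n + n) (grad r p) v = 0 -> dot (n + n) (grad r p) (Jmap n v) = 0 ->
  4 * C * grad_norm (n + n) r p * dot (n + n) v v <= qfJ n (hess r p) v.
Proof.
  intros HO H1 Hr Hp HL T1 T2. set (d := (n + n)%nat) in *.
  destruct (gradients_parallel d Om U1 U r1 r p HO H1 Hr Hp) as [h [Hh Eg]].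
  assert (Gd : forall u, dot d (grad r p) u = h * dot d (grad r1 p) u).
  { intros u. rewrite (dot_ext d (grad r p) (lin h (grad r1 p) 0 (grad r1 p)) u u);
      [rewrite dot_lin_l; ring| |reflexivity].
    intros i Hi. rewrite Eg by assumption. unfold lin; ring. }
  rewrite Gd in T1, T2.
  assert (T1' : dot d (grad r1 p) v = 0) by nra.
  assert (T2' : dot d (grad r1 p) (Jmap n v) = 0) by nra.
  (* A copy of v whose coordinates beyond 2n vanish: it is a legitimate displacement for the
     parabola test and comes from a complex vector to which [HL] applies. *)
  set (w := realvec n (cxvec n v)).
  assert (Ew : forall i, (i < d)%nat -> w i = v i) by (intros; now apply realvec_cxvec).
  assert (EJw : forall i, (i < d)%nat -> Jmap n w i = Jmap n v i) by (intros; now apply Jmap_ext).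
  assert (Hw : inRd d w).
  { intros i Hi. unfold w, realvec. unfold d in Hi.
    destruct (Nat.ltb_spec i n); [lia|]. destruct (Nat.ltb_spec i (n + n)); [lia|reflexivity]. }
  assert (Tw : dot d (grad r1 p) w = 0) by (rewrite (dot_ext d _ _ _ v (fun _ _ => eq_refl) Ew); exact T1').
  assert (TJw : dot d (grad r1 p) (Jmap n w) = 0)
    by (rewrite (dot_ext d _ _ _ _ (fun _ _ => eq_refl) EJw); exact T2').
  pose proof (HL (cxvec n v) (cx_tangent_real n r1 p _ Tw TJw)) as L.
  rewrite levi_real, cnorm2_real in L. fold w d in L.
  pose proof (tangential_hess_compare d Om U1 U r1 r p HO H1 Hr Hp h w Hh Eg Hw Tw) as Q1.
  pose proof (tangential_hess_compare d Om U1 U r1 r p HO H1 Hr Hp h (Jmap n w) Hh Eg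
                (inRd_Jmap n w) TJw) as Q2.
  assert (EN : grad_norm d r p = h * grad_norm d r1 p).
  { rewrite !grad_norm_nrm. rewrite (nrm_ext d _ (fun i => h * pd i r1 p)) by exact Eg.
    rewrite nrm_scal, Rabs_pos_eq by lra. reflexivity. }
  rewrite EN, <- (dot_ext d w v w v Ew Ew).
  assert (Eq : qfJ n (hess r p) v = qfJ n (hess r p) w).
  { unfold qfJ. f_equal; apply qf_ext; auto; intros; symmetry; auto. }
  rewrite Eq. unfold qfJ in *. fold d in L |- *.
  apply Rmult_le_compat_l with (r := 4 * h) in L; [|lra]. lra.
Qed.

(** The bounds M and c replace compactness of the boundary: they make k and L independent of p. *)
Lemma boundary_coercive (n : nat) (Om U1 U : Pt -> Prop) (r1 r : Pt -> R) (C M c : R) :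
  openRd (n + n) Om -> is_defining (n + n) 2 Om U1 r1 -> is_defining (n + n) 2 Om U r ->
  0 < C -> 0 < c -> 0 <= M ->
  (forall p, boundary (n + n) Om p -> forall t, cx_tangent n r1 p t ->
     C * grad_norm (n + n) r1 p * cnorm2 n t <= cre (levi n r1 p t)) ->
  (forall i j x, (i < n + n)%nat -> (j < n + n)%nat -> U x -> Rabs (hess r x i j) <= M) ->
  (forall x, U x -> c <= grad_norm (n + n) r x) ->
  exists k L, 0 < k /\ 0 < L /\ forall p w, boundary (n + n) Om p ->
    k * dot (n + n) w w <= qfJ n (hess r p) w + L * dotJ2 n (grad r p) w.
Proof.
  intros HO H1 Hr HC Hc HM HL HH Hg.
  set (k := 4 * C * c). set (Q := M * (INR (n + n) * INR (n + n))).
  assert (Hk : 0 < k) by (unfold k; repeat apply Rmult_lt_0_compat; lra).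
  assert (HQ : 0 <= Q) by (unfold Q; pose proof (pos_INR (n + n)); apply Rmult_le_pos; nra).
  set (S := 2 * Q + 8 * Q * Q / k + k / 2).
  assert (HS : 0 < S).
  { unfold S. assert (0 <= 8 * Q * Q / k); [|lra]. unfold Rdiv.
    apply Rmult_le_pos; [nra|]. left; now apply Rinv_0_lt_compat. }
  assert (Hcc : 0 < c * c) by nra.
  exists (k / 4), (S / (c * c)). split; [lra|]. split; [now apply Rdiv_lt_0_compat|].
  intros p w Hp. assert (Up : U p) by now apply Hr.
  assert (Gp : c <= nrm (n + n) (grad r p)).
  { specialize (Hg p Up). rewrite grad_norm_nrm in Hg. exact Hg. }
  apply (coercive_of_tangential n (hess r p) (grad r p) w M k c); auto.
  - rewrite <- nrm_sqr. nra.
  - intros v T1 T2.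
    eapply Rle_trans; [|apply (tangential_levi_transfer n Om U1 U r1 r C p v); auto].
    apply Rmult_le_compat_r; [apply dot_self_nonneg|]. unfold k.
    apply Rmult_le_compat_l; [lra|auto].
  - fold Q S. right. field. lra.
Qed.

Lemma strictly_psh_on_boundary (n : nat) (Om U : Pt -> Prop) (r : Pt -> R) (k L : R) :
  openRd (n + n) Om -> is_defining (n + n) 2 Om U r -> 0 < k -> 0 < L ->
  (forall p w, boundary (n + n) Om p ->
    k * dot (n + n) w w <= qfJ n (hess r p) w + L * dotJ2 n (grad r p) w) ->
  (* The parameter eta = 2 / L below makes F''/F' equal to L at s = 0, exactly the weight of the
     rank-one term in the coercivity hypothesis. *)
  exists rho, is_defining (n + n) 2 Om U rho /\
    forall p, boundary (n + n) Om p -> spsh_at n rho p.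
Proof.
  intros HO Hr Hk HL H. set (eta := 2 / L).
  assert (He : 0 < eta) by (apply Rdiv_lt_0_compat; lra).
  exists (fun y => bump eta (r y)). split.
  - apply (is_defining_bump _ Om U); auto; apply Hr.
  - intros p Hp t [j [Hj Nt]]. rewrite levi_real.
    pose proof (realvec_pos n j t Hj Nt) as P.
    pose proof (defining_boundary_0 _ _ _ _ _ _ HO Hr Hp) as Z.
    assert (Em : pospart (r p + eta) = eta)
      by (unfold pospart; rewrite Z, Rmax_right; lra).
    pose proof (qfJ_bump_lower n U r eta k L p (realvec n t)) as B.
    rewrite Em in B. specialize (B ltac:(apply Hr) ltac:(apply Hr) ltac:(now apply Hr)).
    assert (E2 : eta * L = 2) by (unfold eta; field; lra).
    specialize (B ltac:(lra) (H p _ Hp)).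
    assert (0 < 3 * eta ^ 2 * (k * dot (n + n) (realvec n t) (realvec n t))).
    { apply Rmult_lt_0_compat; [nra|]. now apply Rmult_lt_0_compat. }
    lra.
Qed.

(** * Extension to the whole domain *)

(* A step of length s along the gradient leaves Om as soon as r > - s c / 2. *)
Lemma shallow_points_near_boundary (d : nat) (Om U : Pt -> Prop) (r : Pt -> R)
  (M c delta a s : R) (x p : Pt) :
  is_defining d 2 Om U r ->
  (forall i j y, (i < d)%nat -> (j < d)%nat -> U y -> Rabs (hess r y i j) <= M) -> 0 <= M ->
  0 < c -> (forall y, U y -> c <= grad_norm d r y) ->
  (forall q z, boundary d Om q -> inRd d z -> distRd d q z < delta -> U z) ->
  0 < s -> a + s <= delta -> s * (M * (INR d * INR d)) <= c ->
  boundary d Om p -> inRd d x -> distRd d x p < a -> Om x -> - (s * c / 2) <= r x ->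
  exists q, boundary d Om q /\ distRd d x q <= s.
Proof.
  intros (HU & BU & CU & SU & GU) HM PM Hc Hg HB Hs Has HsK Hp Hx Dx Ox Hr.
  assert (Seg0 : forall z, inRd d z -> distRd d x z <= s -> U z).
  { intros z Hz Dz. apply (HB p); auto. pose proof (distRd_triangle d p x z) as T.
    rewrite (distRd_sym d p x) in T. lra. }
  assert (Ux : U x) by (apply Seg0; [exact Hx|rewrite distRd_refl; lra]).
  assert (Gx : c <= nrm d (grad r x)).
  { specialize (Hg x Ux). rewrite grad_norm_nrm in Hg. exact Hg. }
  set (G := nrm d (grad r x)) in *.
  (* A step of length s along the gradient. With y = x + u, the Taylor formula gives r(y) >= - s c /
     2 + s G - s c / 2 >= 0, the bound on s limiting the quadratic term to s c / 2; so y is outside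
     Om. *)
  set (u := trunc d (lin (s / G) (grad r x) 0 x)).
  assert (Hu : inRd d u) by apply inRd_trunc.
  assert (Nu : nrm d u <= s).
  { unfold u. rewrite nrm_trunc. eapply Rle_trans; [apply nrm_lin_le|]. fold G.
    rewrite Rabs_R0, Rabs_pos_eq; [right; field; lra|].
    left; apply Rdiv_lt_0_compat; lra. }
  assert (Du : dot d (grad r x) u = s * G).
  { unfold u. rewrite dot_trunc_r, dot_lin_r, <- nrm_sqr. fold G. field. lra. }
  assert (Seg : forall t, 0 <= t <= 1 ->
    inRd d (lin 1 x t u) /\ distRd d x (lin 1 x t u) <= s /\ U (lin 1 x t u)).
  { intros t Ht.
    assert (I : inRd d (lin 1 x t u)) by (apply inRd_lin; assumption).
    assert (D : distRd d x (lin 1 x t u) <= s).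
    { rewrite distRd_lin, Rabs_pos_eq by lra. pose proof (nrm_nonneg d u). nra. }
    auto. }
  destruct (taylor_2 d U r x u HU CU Hu) as [t [Ht E]]; [intros; now apply Seg|].
  destruct (Seg t Ht) as (_ & _ & Ut). destruct (Seg 1 ltac:(lra)) as (I1 & D1 & U1).
  set (y := lin 1 x 1 u) in *.
  assert (Q : Rabs (qf d (hess r (lin 1 x t u)) u u) <= s * c).
  { eapply Rle_trans; [apply qf_bound with (a := M); auto|].
    pose proof (pos_INR d). pose proof (nrm_nonneg d u).
    assert (0 <= M * (INR d * INR d)) by (apply Rmult_le_pos; nra).
    apply Rle_trans with (M * (INR d * INR d) * (s * s)).
    - apply Rmult_le_compat_l; [assumption|]. apply Rmult_le_compat; assumption.
    - nra. }
  apply Rabs_le_between in Q. rewrite Du in E.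
  assert (Ny : ~ Om y).
  { intros Oy. apply SU in Oy; [|exact U1]. assert (s * c <= s * G) by nra. lra. }
  destruct (segment_boundary d Om x y Hx I1 Ox Ny) as [q [Hq Dq]].
  exists q; split; [exact Hq|lra].
Qed.

(** * Gluing the composed function on a collar to a constant inside *)

Section Gluing.

Variables (n : nat) (Om U : Pt -> Prop) (r : Pt -> R) (a s eta : R).
Let d := (n + n)%nat.
Hypothesis HO : openRd d Om.
Hypothesis Hr : is_defining d 2 Om U r.
Hypothesis Ha : 0 < a.
Hypothesis Hs : 4 * s <= a.
Hypothesis Heta : 0 < eta.

Let near (x : Pt) : Prop := inRd d x /\ exists p, boundary d Om p /\ distRd d x p < a.

Hypothesis near_U : forall x, near x -> U x.
Hypothesis shallow : forall x, near x -> Om x -> - eta <= r x ->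
  exists q, boundary d Om q /\ distRd d x q <= s.

Let rho (x : Pt) : R :=
  if excluded_middle_informative (near x) then bump eta (r x) else - eta ^ 3.

Let rho_near (x : Pt) : near x -> rho x = bump eta (r x).
Proof. intros H. unfold rho. destruct (excluded_middle_informative (near x)); tauto. Qed.

Let openRd_near : openRd d near.
Proof. apply openRd_near_boundary. Qed.

Let near_boundary (p : Pt) : boundary d Om p -> near p.
Proof.
  intros Hp. split; [apply Hp|]. exists p; split; [exact Hp|]. now rewrite distRd_refl.
Qed.

(** A point y within a / 2 of x that lies in the collar with r(y) > -eta would be within s <= a / 4
    of the boundary, which would put x in the collar. So r <= -eta on the overlap, where F(r)
    already equals the constant. *)
Let rho_far (x : Pt) : Om x -> ~ near x ->
  exists W, openRd d W /\ W x /\ forall y, W y -> rho y = - eta ^ 3.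
Proof.
  intros Ox Nx. destruct HO as [HO1 HO2]. destruct (HO2 x Ox) as [b [Hb Kb]].
  exists (fun y => inRd d y /\ distRd d x y < Rmin b (a / 2)).
  pose proof (Rmin_l b (a / 2)). pose proof (Rmin_r b (a / 2)).
  split; [apply openRd_ball|]. split.
  - split; [auto|]. rewrite distRd_refl. apply Rmin_pos; lra.
  - intros y [Hy Dy]. unfold rho. destruct (excluded_middle_informative (near y)) as [N|N];
      [|reflexivity].
    apply bump_below. apply Rnot_lt_le. intros L. apply Nx.
    destruct (shallow y N) as [q [Hq Dq]]; [apply Kb; auto; lra|lra|].
    split; [auto|]. exists q; split; [exact Hq|].
    pose proof (distRd_triangle d x y q). lra.
Qed.

Lemma glued_defining : is_defining d 2 Om near rho.
Proof.
  pose proof (is_defining_bump d Om U near r eta Heta HO Hr openRd_near near_U near_boundary)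
    as (H1 & H2 & H3 & H4 & H5).
  split; [exact H1|]. split; [exact H2|]. split; [|split].
  - apply (Cm_ext d 2 near _ (fun y => bump eta (r y))); auto.
  - intros x Nx. rewrite rho_near by exact Nx. auto.
  - intros p Hp. pose proof (near_boundary p Hp) as Np.
    rewrite grad_norm_nrm, (nrm_ext d _ (fun i => pd i (fun y => bump eta (r y)) p)).
    + rewrite <- grad_norm_nrm. auto.
    + intros i Hi. apply (pd_local d i near); auto.
Qed.

Lemma glued_Cm : Cm d 2 (fun x => Om x \/ near x) rho.
Proof.
  apply Cm_local. intros x Vx. destruct (classic (near x)) as [N|N].
  - exists near, rho. split; [exact openRd_near|]. split; [exact N|]. split; [reflexivity|].
    apply glued_defining.
  - destruct (rho_far x) as [W (HW & Wx & E)]; [tauto|exact N|].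
    exists W, (fun _ => - eta ^ 3). split; [exact HW|]. split; [exact Wx|].
    split; [exact E|apply Cm_const].
Qed.

Lemma glued_open : openRd d (fun x => Om x \/ near x).
Proof.
  destruct HO as [HO1 HO2]. destruct openRd_near as [HN1 HN2].
  split; [intros x [H|H]; auto|]. intros x [H|H].
  - destruct (HO2 x H) as [b [Hb K]]. exists b; split; auto.
  - destruct (HN2 x H) as [b [Hb K]]. exists b; split; auto.
Qed.

Lemma glued_closure (x : Pt) : closure d Om x -> Om x \/ near x.
Proof.
  intros [Hx H]. destruct (classic (Om x)) as [O|N]; [now left|right].
  apply near_boundary. split; [exact Hx|]. intros e He. split; [auto|].
  exists x. rewrite distRd_refl. auto.
Qed.

Lemma glued_neg (x : Pt) : Om x -> rho x < 0.
Proof.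
  intros Ox. unfold rho. destruct (excluded_middle_informative (near x)) as [N|N].
  - apply bump_neg; [exact Heta|]. apply Hr; auto.
  - assert (0 < eta ^ 3) by now apply pow_lt. lra.
Qed.

Variables (k L : R).
Hypothesis Hk : 0 < k.
Hypothesis HL : eta * L <= 2.
Hypothesis L_pos : 0 < L.
Hypothesis coercive : forall x w, near x ->
  k * dot d w w <= qfJ n (hess r x) w + L * dotJ2 n (grad r x) w.

Let glued_lower (x v : Pt) : Om x -> near x ->
  3 * pospart (r x + eta) ^ 2 * (k * dot d v v) <= qfJ n (hess rho x) v.
Proof.
  intros Ox N.
  rewrite (qfJ_ext n _ (hess (fun y => bump eta (r y)) x)).
  - apply (qfJ_bump_lower n U r eta k L); auto; try apply Hr.
    apply Rle_trans with (eta * L); [|exact HL].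
    apply Rmult_le_compat_r; [lra|].
    assert (r x < 0) by (apply Hr; auto).
    unfold pospart. apply Rmax_lub; lra.
  - intros i j Hi Hj. apply (hess_local d i j near); auto.
Qed.

Lemma glued_psh (x : Pt) : Om x -> psh_at n rho x.
Proof.
  intros Ox t. rewrite levi_real. apply Rmult_le_pos; [lra|].
  destruct (classic (near x)) as [N|N].
  - eapply Rle_trans; [|apply glued_lower; assumption].
    pose proof (dot_self_nonneg d (realvec n t)). apply Rmult_le_pos; [nra|].
    apply Rmult_le_pos; lra.
  - destruct (rho_far x Ox N) as [W (HW & Wx & E)].
    rewrite qfJ_0; [lra|]. intros i j Hi Hj.
    rewrite (hess_local d i j W rho (fun _ => - eta ^ 3)) by assumption.
    unfold hess. now rewrite !pd_const.
Qed.

Lemma glued_spsh (x : Pt) : Om x -> near x -> - eta < r x -> spsh_at n rho x.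
Proof.
  intros Ox N Hx t [j [Hj Nt]]. rewrite levi_real. apply Rmult_lt_0_compat; [lra|].
  eapply Rlt_le_trans; [|apply glued_lower; assumption].
  apply Rmult_lt_0_compat.
  - unfold pospart. rewrite Rmax_right by lra.
    assert (0 < (r x + eta) ^ 2) by (apply pow_lt; lra). lra.
  - apply Rmult_lt_0_compat; [exact Hk|]. now apply (realvec_pos n j).
Qed.

Lemma glued_exists (eps : R) : 0 < eps ->
  (forall x p, Om x -> boundary d Om p -> distRd d x p < eps -> near x /\ - eta < r x) ->
  exists eps, 0 < eps /\
  exists (V : Pt -> Prop) (rho : Pt -> R),
    openRd d V /\ (forall x, closure d Om x -> V x) /\ Cm d 2 V rho /\
    (exists U : Pt -> Prop, is_defining d 2 Om U rho) /\
    (forall x, Om x -> rho x < 0) /\ (forall x, Om x -> psh_at n rho x) /\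
    (forall x, Om x -> (exists p, boundary d Om p /\ distRd d x p < eps) -> spsh_at n rho x).
Proof.
  intros He H. exists eps; split; [exact He|].
  exists (fun x => Om x \/ near x), rho.
  split; [apply glued_open|]. split; [apply glued_closure|]. split; [apply glued_Cm|].
  split; [exists near; apply glued_defining|]. split; [apply glued_neg|].
  split; [apply glued_psh|]. intros x Ox [p [Hp Dp]].
  destruct (H x p Ox Hp Dp). now apply glued_spsh.
Qed.

End Gluing.

Lemma plurisubharmonic_on_domain (n : nat) (Om U : Pt -> Prop) (r : Pt -> R) (M c delta k L : R) :
  let d := (n + n)%nat in
  openRd d Om -> is_defining d 2 Om U r -> Cm d 3 U r -> 0 <= M ->
  (forall i x, (i < d)%nat -> U x -> Rabs (grad r x i) <= M) ->
  (forall i j x, (i < d)%nat -> (j < d)%nat -> U x -> Rabs (hess r x i j) <= M) ->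
  (forall l i j x, (l < d)%nat -> (i < d)%nat -> (j < d)%nat -> U x ->
     Rabs (pd l (pd i (pd j r)) x) <= M) ->
  0 < c -> (forall x, U x -> c <= grad_norm d r x) ->
  0 < delta ->
  (forall q z, boundary d Om q -> inRd d z -> distRd d q z < delta -> U z) ->
  0 < k -> 0 < L ->
  (forall p w, boundary d Om p ->
    k * dot d w w <= qfJ n (hess r p) w + L * dotJ2 n (grad r p) w) ->
  exists eps, 0 < eps /\
  exists (V : Pt -> Prop) (rho : Pt -> R),
    openRd d V /\ (forall x, closure d Om x -> V x) /\ Cm d 2 V rho /\
    (exists U : Pt -> Prop, is_defining d 2 Om U rho) /\
    (forall x, Om x -> rho x < 0) /\ (forall x, Om x -> psh_at n rho x) /\
    (forall x, Om x -> (exists p, boundary d Om p /\ distRd d x p < eps) -> spsh_at n rho x).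
Proof.
  intros d HO Hr C3 PM M1 M2 M3 Hc Hg Hdel HB Hk HL Hco.
  assert (PD : 0 <= INR d) by apply pos_INR. set (D := INR d) in *.
  assert (PMD : 0 <= M * D) by now apply Rmult_le_pos.
  assert (PML : 0 <= L * M) by (apply Rmult_le_pos; lra).
  (* On a collar of width a, gradient and Hessian change by at most M D a, so [coercive_perturb]
     costs a * X; the choice of [a] leaves at least half of k. The summand 1 in X + 1 only avoids a
     zero denominator. *)
  set (X := M * D * (2 + 4 * L * M) * (D * D)).
  assert (PX : 0 <= X) by (unfold X; repeat apply Rmult_le_pos; nra).
  set (a := Rmin (delta / 2) (k / (2 * (X + 1)))).
  assert (Ha : 0 < a) by (apply Rmin_pos; [lra|apply Rdiv_lt_0_compat; lra]).
  assert (Ha1 : a <= delta / 2) by apply Rmin_l.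
  assert (Ha2 : a * X <= k / 2).
  { assert (a <= k / (2 * (X + 1))) by apply Rmin_r.
    apply Rle_trans with (k / (2 * (X + 1)) * (X + 1)); [|right; field; lra].
    apply Rmult_le_compat; lra. }
  assert (PK : 0 <= M * (D * D)) by (apply Rmult_le_pos; nra).
  (* The first bound leaves the margin used in the gluing; the second makes the linear term dominate
     the quadratic one over a gradient step of length s. *)
  set (s := Rmin (a / 4) (c / (M * (D * D) + 1))).
  assert (Hs : 0 < s) by (apply Rmin_pos; [lra|apply Rdiv_lt_0_compat; lra]).
  assert (Hs1 : s <= a / 4) by apply Rmin_l.
  assert (Hs2 : s * (M * (D * D)) <= c).
  { assert (s <= c / (M * (D * D) + 1)) by apply Rmin_r.
    apply Rle_trans with (c / (M * (D * D) + 1) * (M * (D * D) + 1)); [|right; field; lra].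
    apply Rmult_le_compat; lra. }
  (* The first bound makes collar points of Om with r >= -eta lie within s of the boundary; the
     second gives F''/F' >= L wherever -eta < r <= 0. *)
  set (eta := Rmin (s * c / 2) (2 / L)).
  assert (Psc : 0 < s * c) by now apply Rmult_lt_0_compat.
  assert (Heta : 0 < eta) by (apply Rmin_pos; [lra|apply Rdiv_lt_0_compat; lra]).
  assert (Heta1 : eta <= s * c / 2) by apply Rmin_l.
  assert (Heta2 : eta * L <= 2).
  { assert (eta <= 2 / L) by apply Rmin_r.
    apply Rle_trans with (2 / L * L); [|right; field; lra]. apply Rmult_le_compat_r; lra. }
  assert (near_U : forall x, (inRd d x /\ exists p, boundary d Om p /\ distRd d x p < a) -> U x).
  { intros x [Hx [p [Hp Dp]]]. apply (HB p); auto. rewrite distRd_sym. lra. }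
  assert (Path : forall x p, inRd d x -> boundary d Om p -> distRd d x p < a ->
    forall z, inRd d z -> distRd d p z <= distRd d p x -> U z).
  { intros x p Hx Hp Dp z Hz Dz. rewrite (distRd_sym d p x) in Dz. apply (HB p); auto; lra. }
  (* Since r vanishes on the boundary and changes at rate at most M D, it stays above -eta at
     distance less than [eps], where F' is therefore positive. *)
  set (eps := Rmin a (eta / (M * D + 1))).
  assert (Heps : 0 < eps) by (apply Rmin_pos; [lra|apply Rdiv_lt_0_compat; lra]).
  apply (glued_exists n Om U r a s eta HO Hr Ha ltac:(lra) Heta near_U) with (k := k / 2) (L := L) (eps := eps);
    try assumption; try lra.
  - intros x [Hx [p [Hp Dp]]] Ox Hrx.
    apply (shallow_points_near_boundary d Om U r M c delta a s x p); auto; lra.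
  - intros x w [Hx [p [Hp Dp]]].
    pose proof (Path x p Hx Hp Dp) as Pa.
    assert (Up : U p) by now apply Hr.
    assert (Ux : U x) by (apply near_U; eauto).
    assert (Dpx : 0 <= distRd d p x < a) by (split; [apply distRd_nonneg|now rewrite distRd_sym]).
    pose proof (coercive_perturb n (hess r p) (hess r x) (grad r p) (grad r x) w
      (M * D * a) M k L) as CP. fold d D in CP.
    assert (E : (k - M * D * a * (2 + 4 * L * M) * (D * D)) = k - a * X) by (unfold X; ring).
    rewrite E in CP.
    eapply Rle_trans; [|apply CP]; auto; try nra.
    + apply Rmult_le_compat_r; [apply dot_self_nonneg|lra].
    + intros i j Hi Hj.
      apply Rle_trans with (M * D * distRd d p x); [|apply Rmult_le_compat_l; lra].
      apply (lipschitz_of_partials d U); auto; [|apply Hp].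
      apply Cm_pd, Cm_pd; assumption.
    + intros i Hi.
      apply Rle_trans with (M * D * distRd d p x); [|apply Rmult_le_compat_l; lra].
      apply (lipschitz_of_partials d U (pd i r)); auto; [| |apply Hp].
      * apply Cm_pd; [assumption|]. now apply Cm_pred.
      * intros j z Hj Uz. now apply M2.
  - intros x p Ox Hp Dp.
    assert (Hx : inRd d x) by now apply HO.
    assert (Da : distRd d x p < a) by (eapply Rlt_le_trans; [exact Dp|apply Rmin_l]).
    split; [split; [exact Hx|exists p; auto]|].
    pose proof (lipschitz_of_partials d U r M p x) as Lp.
    assert (Z : r p = 0) by exact (defining_boundary_0 _ _ _ _ _ _ HO Hr Hp).
    rewrite Z in Lp.
    assert (Rb : Rabs (r x - 0) <= M * D * distRd d p x).
    { apply Lp; auto; [do 2 apply Cm_pred; assumption|apply Hp|now apply Path]. }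
    rewrite (distRd_sym d p x) in Rb.
    assert (De : distRd d x p < eta / (M * D + 1)) by (eapply Rlt_le_trans; [exact Dp|apply Rmin_r]).
    apply Rmult_lt_compat_r with (r := M * D + 1) in De; [|lra].
    replace (eta / (M * D + 1) * (M * D + 1)) with eta in De by (field; lra).
    pose proof (distRd_nonneg d x p). apply Rabs_le_between in Rb. nra.
Qed.

Lemma unif_defining_bound (d m : nat) (Om U : Pt -> Prop) (r : Pt -> R) :
  unif_defining d m Om U r ->
  exists M, 0 <= M /\ forall l, (length l <= m)%nat -> List.Forall (fun i => (i < d)%nat) l ->
    forall x, U x -> Rabs (pdl l r x) <= M.
Proof.
  intros (_ & _ & [M H] & _). exists (Rabs M). split; [apply Rabs_pos|].
  intros l Hl Fl x Ux. eapply Rle_trans; [now apply H|apply Rle_abs].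
Qed.

Theorem theorem4p1 (n : nat) (Om : Pt -> Prop) :
  domain (2 * n)%nat Om ->
  (exists (U : Pt -> Prop) (r : Pt -> R),
      is_defining (2 * n)%nat 2 Om U r /\
      exists C, 0 < C /\
        forall p, boundary (2 * n)%nat Om p ->
        forall t : nat -> Cx, cx_tangent n r p t ->
          C * grad_norm (2 * n)%nat r p * cnorm2 n t <= cre (levi n r p t)) ->
  ((exists (U : Pt -> Prop) (r : Pt -> R), unif_defining (2 * n)%nat 2 Om U r) ->
     exists (U : Pt -> Prop) (rho : Pt -> R),
       is_defining (2 * n)%nat 2 Om U rho /\
       forall p, boundary (2 * n)%nat Om p -> spsh_at n rho p)
  /\
  ((exists (U : Pt -> Prop) (r : Pt -> R), unif_defining (2 * n)%nat 3 Om U r) ->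
     exists eps, 0 < eps /\
     exists (V : Pt -> Prop) (rho : Pt -> R),
       openRd (2 * n)%nat V /\
       (forall x, closure (2 * n)%nat Om x -> V x) /\
       Cm (2 * n)%nat 2 V rho /\
       (exists U : Pt -> Prop, is_defining (2 * n)%nat 2 Om U rho) /\
       (forall x, Om x -> rho x < 0) /\
       (forall x, Om x -> psh_at n rho x) /\
       (forall x, Om x ->
          (exists p, boundary (2 * n)%nat Om p /\ distRd (2 * n)%nat x p < eps) ->
          spsh_at n rho x)).
Proof.
  replace (2 * n)%nat with (n + n)%nat by lia.
  intros [HO _] (U1 & r1 & H1 & C & HC & HL).
  (* Stated for every m so that it reads off Hessian bounds from both the C^2 and the C^3
     hypothesis. *)
  assert (Hess : forall m (U : Pt -> Prop) r M,
    (forall l, (length l <= S (S m))%nat -> List.Forall (fun i => (i < n + n)%nat) l ->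
      forall x, U x -> Rabs (pdl l r x) <= M) ->
    forall i j x, (i < n + n)%nat -> (j < n + n)%nat -> U x -> Rabs (hess r x i j) <= M).
  { intros m U r M HM i j x Hi Hj Ux. apply (HM (i :: j :: nil)%list); [simpl; lia|auto|assumption]. }
  split.
  - intros (U & r & Hu).
    destruct (unif_defining_bound _ _ _ _ _ Hu) as [M [PM HM]].
    destruct Hu as (Hr & _ & _ & c & Hc & Hg).
    destruct (boundary_coercive n Om U1 U r1 r C M c HO H1 Hr HC Hc PM HL
                (Hess 0%nat U r M HM) Hg) as (k & L & Hk & HLp & K).
    destruct (strictly_psh_on_boundary n Om U r k L HO Hr Hk HLp K) as [rho Hrho].
    now exists U, rho.
  - intros (U & r & Hu).
    destruct (unif_defining_bound _ _ _ _ _ Hu) as [M [PM HM]].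
    destruct (unif_defining_ball _ _ _ _ _ Hu) as [delta [Hdel HB]].
    destruct Hu as (Hr3 & _ & _ & c & Hc & Hg).
    assert (Hr : is_defining (n + n) 2 Om U r).
    { destruct Hr3 as (A1 & A2 & A3 & A4). split; [exact A1|]. split; [exact A2|].
      split; [now apply Cm_pred|exact A4]. }
    destruct (boundary_coercive n Om U1 U r1 r C M c HO H1 Hr HC Hc PM HL
                (Hess 1%nat U r M HM) Hg) as (k & L & Hk & HLp & K).
    apply (plurisubharmonic_on_domain n Om U r M c delta k L); auto.
    + apply Hr3.
    + intros i x Hi Ux. apply (HM (i :: nil)%list); [simpl; lia|auto|assumption].
    + exact (Hess 1%nat U r M HM).
    + intros l i j x Hl Hi Hj Ux. apply (HM (l :: i :: j :: nil)%list); [simpl; lia|auto|assumption].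
Qed.
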